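(* There exists a finitely generated, residually finite, infinite group $\Gamma$ with $\rho(\Gamma)=0$.
   Context: For a group $\Gamma$, let $r_n(\Gamma)$ be the number of isomorphism classes of irreducible complex representations of $\Gamma$ of dimension $n$, and $R_n(\Gamma)=\sum_{i=1}^n r_i(\Gamma)$. Then $\rho(\Gamma)=\limsup_{n\to\infty}\frac{\log R_n(\Gamma)}{\log n}$, with the convention $\rho(\Gamma)=\infty$ if some $R_n(\Gamma)$ is infinite or $R_n(\Gamma)$ is not polynomially bounded. *)

(* Defs.v *)
From HB Require Import structures.
From mathcomp Require Import all_boot all_order all_algebra all_fingroup.
From mathcomp Require Import all_classical all_reals all_analysis.
From mathcomp Require Import complex.
From mathcomp Require Import Rstruct.

Set Implicit Arguments.
Unset Strict Implicit.
Unset Printing Implicit Defensive.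

Import Order.TTheory GRing.Theory Num.Theory.
Local Open Scope ring_scope.

Definition C : Type := complex Rdefinitions.R.

Section GroupDefs.
Variable G : groupType.
Local Open Scope group_scope.

Definition in_gen (S : seq G) (x : G) : Prop :=
  forall P : G -> Prop,
    P 1 -> (forall a b, P a -> P b -> P (a * b)) -> (forall a, P a -> P a^-1) ->
    (forall s, s \in S -> P s) -> P x.

Definition finitely_generated : Prop :=
  exists S : seq G, forall x : G, in_gen S x.

Definition infinite_group : Prop :=
  ~ (exists s : seq G, forall x : G, x \in s).

Definition residually_finite : Prop :=
  forall x : G, x != 1 ->
    exists (H : finGroupType) (f : G -> H),
      (forall a b, f (a * b) = f a * f b) /\ f x != 1.

End GroupDefs.

Section RepDefs.
Variable G : groupType.

(* complex linear representations of G of dimension m (matrices act on row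
   vectors on the right, MathComp convention) *)
Definition is_rep (m : nat) (rho : G -> 'M[C]_m) : Prop :=
  rho 1%g = 1%:M /\ forall a b : G, rho (a * b)%g = rho a *m rho b.

Definition rep_irreducible (m : nat) (rho : G -> 'M[C]_m) : Prop :=
  (0 < m)%N /\
  forall U : 'M[C]_m, (forall g : G, stablemx U (rho g)) ->
    U = 0 \/ row_full U.

Definition rep_iso (m1 m2 : nat) (rho1 : G -> 'M[C]_m1) (rho2 : G -> 'M[C]_m2)
  : Prop :=
  exists e : m1 = m2, exists P : 'M[C]_m2, P \in unitmx /\
    forall g : G, castmx (e, e) (rho1 g) *m P = P *m rho2 g.

Definition drep := {m : nat & G -> 'M[C]_m}.

Definition irr_upto (n : nat) (r : drep) : Prop :=
  (projT1 r <= n)%N /\ is_rep (projT2 r) /\ rep_irreducible (projT2 r).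

Definition covers (n : nat) (k : nat) : Prop :=
  exists s : seq drep, (size s <= k)%N /\
    (forall r, List.In r s -> irr_upto n r) /\
    forall r, irr_upto n r -> exists2 r', List.In r' s & rep_iso (projT2 r) (projT2 r').

(* R_n(G) = number of isomorphism classes of irreducible complex reps of
   dimension <= n (the least number of representatives), +oo if infinite *)
Definition R_count (n : nat) : \bar Rdefinitions.R :=
  ereal_inf [set (k%:R)%:E | k in covers n].

Definition rho_seq (n : nat) : \bar Rdefinitions.R :=
  match R_count n with
  | EFin r => (ln r / ln n%:R)%:E
  | _ => +oo%E
  end.

Definition rep_growth : \bar Rdefinitions.R :=
  if `[< exists n, R_count n = +oo%E >] then +oo%E else limn_esup rho_seq.

End RepDefs.

(* Main.v *)
(* Gamma is a finitely generated group EL_3(R) inside prod_i GL_3(M_k(F_2)),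
   k = 2^i, where R contains every finitely supported sequence of matrices, and
   modulo those sequences R has no proper ideal of finite index (this uses the
   cshift and a diagonal matrix carrying the period-doubling word). The kernel of
   a representation on C^n meets each root subgroup R in one fixed ideal; the
   image of R is an elementary abelian 2-group of diagonalizable matrices, so
   the ideal has finite index and contains all sequences vanishing below some
   level. Hence finite-dimensional representations factor through finitely many
   GL_d(F_2), d = 3 * 2^i.

   In an irreducible representation of GL_d(F_2), successively diagonalizing the
   first row of the remaining GL gives an eigenvector, after j steps, for the
   group Q_j of matrices unitriangular in their first j rows and arbitrary below.
   At least every other step meets a nontrivial character, whose orbit is large,
   so the dimension is at least 2^(j(d-2)/4). Matrix coefficients between such
   eigenvectors of V and of its dual are equivariant under unitriangular matrices
   and Q_j, hence determined by d^j values (Bruhat), and by Schur orthogonality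
   those of non-isomorphic representations are linearly independent. So the
   number of irreducible representations of dimension at most n is only
   exp(O(sqrt L * (log L)^2)) with L = log n. *)
From HB Require Import structures.
Require Import Defs.
From mathcomp Require Import all_boot all_order all_algebra all_fingroup.
From mathcomp Require Import all_classical all_reals all_analysis.
From mathcomp Require Import complex Rstruct zify.

Set Implicit Arguments.
Unset Strict Implicit.
Unset Printing Implicit Defensive.
Import Order.TTheory GRing.Theory Num.Theory.
Import numFieldNormedType.Exports.
Local Open Scope ring_scope.

(** * Matrices over F_2 *)

Lemma F2_cases (x : 'F_2) : x = 0 \/ x = 1.
Proof. by case: x => -[|[|//]] h; [left|right]; apply: val_inj. Qed.

Lemma F2_neq0 (x : 'F_2) : x != 0 -> x = 1.
Proof. by case: (F2_cases x) => ->; rewrite ?eqxx. Qed.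

Lemma F2mx_addrr m n (A : 'M['F_2]_(m, n)) : A + A = 0.
Proof. by apply/matrixP=> i j; rewrite !mxE; case: (F2_cases (A i j)) => ->; apply: val_inj. Qed.

Lemma F2mx_oppr m n (A : 'M['F_2]_(m, n)) : - A = A.
Proof. by apply/eqP; rewrite eq_sym -addr_eq0 F2mx_addrr. Qed.

Lemma F2_transvecK n (p q : 'I_n) : p != q ->
  (1%:M + delta_mx p q) *m (1%:M + delta_mx p q) = 1%:M :> 'M['F_2]_n.
Proof.
move=> npq; rewrite mulmxDl mul1mx mulmxDr mulmx1 mul_delta_mx_cond eq_sym (negPf npq).
by rewrite mulr0n addr0 -addrA F2mx_addrr addr0.
Qed.

(** For invertible h this is the stabilizer of the first basis column in GL_(1+m): the rows x form
    an abelian normal subgroup with complement GL_m. *)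
Definition aff m (x : 'rV['F_2]_m) (h : 'M['F_2]_m) : 'M['F_2]_(1 + m) :=
  block_mx 1%:M x 0 h.

Lemma affM m (x y : 'rV_m) (g h : 'M[_]_m) : aff x h *m aff y g = aff (y + x *m g) (h *m g).
Proof. by rewrite /aff mulmx_block !mul1mx !mul0mx !mulmx0 !addr0 add0r. Qed.

Lemma aff_unit m (x : 'rV_m) (h : 'M[_]_m) : (aff x h \in unitmx) = (h \in unitmx).
Proof. by rewrite !unitmxE det_ublock det1 mul1r. Qed.

Lemma aff01 m : aff 0 1%:M = 1%:M :> 'M[_]_(1 + m).
Proof. by rewrite /aff -scalar_mx_block. Qed.

Lemma affE m (x : 'rV_m) h : aff x h = aff 0 h *m aff x 1%:M.
Proof. by rewrite affM mul0mx addr0 mulmx1. Qed.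

Lemma affD m (x y : 'rV_m) : aff (x + y) 1%:M = aff x 1%:M *m aff y 1%:M.
Proof. by rewrite affM !mulmx1 addrC. Qed.

Lemma delta_block m (i j : 'I_m) :
  (delta_mx (lshift m 0) (rshift 1 j) = block_mx 0 (delta_mx 0 j) 0 0 :> 'M['F_2]_(1 + m)) *
  (delta_mx (rshift 1 i) (lshift m 0) = block_mx 0 0 (delta_mx i 0) 0 :> 'M['F_2]_(1 + m)) *
  (delta_mx (rshift 1 i) (rshift 1 j) = block_mx 0 0 0 (delta_mx i j) :> 'M['F_2]_(1 + m)).
Proof.
do 2?split; rewrite ?delta_mx_ushift ?delta_mx_dshift ?delta_mx_lshift ?delta_mx_rshift.
all: by rewrite /block_mx ?row_mx0.
Qed.

Lemma aff1_ind_transvec m (P : 'M['F_2]_(1 + m) -> Prop) :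
  P 1%:M -> (forall p q, p != q -> P (1%:M + delta_mx p q)) ->
  (forall A B, P A -> P B -> P (A *m B)) ->
  forall x, P (aff x 1%:M).
Proof.
move=> P1 Pt PM x; rewrite (row_sum_delta x).
elim/big_rec: _ => [|j y _ Py]; first by rewrite aff01.
rewrite affD; apply: (PM) Py.
case: (F2_cases (x 0 j)) => ->; first by rewrite scale0r aff01.
rewrite scale1r; suff -> : aff (delta_mx 0 j) 1%:M = 1%:M + delta_mx (lshift m 0) (rshift 1 j).
  exact: (Pt).
by rewrite (delta_block j j) -aff01 /aff add_block_mx !addr0 add0r.
Qed.

(** Gaussian elimination: the only nonzero pivot over F_2 is 1, so transvections generate. A matrix
    with corner entry 1 splits into a lower and an affine factor; a zero corner is first made 1 by
    adding another row to the first. *)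
Lemma unitmx_ind_transvec m (P : 'M['F_2]_m -> Prop) :
  P 1%:M -> (forall p q, p != q -> P (1%:M + delta_mx p q)) ->
  (forall A B, P A -> P B -> P (A *m B)) ->
  forall A, A \in unitmx -> P A.
Proof.
elim: m P => [|m IH] P P1 Pt PM A.
  by move=> _; rewrite (_ : A = 1%:M) // [LHS]flatmx0 [RHS]flatmx0.
have Paff x : P (aff x 1%:M) by apply: (aff1_ind_transvec P1 Pt PM).
have Plow (c : 'cV_m) : P (block_mx 1%:M 0 c 1%:M).
  have -> : block_mx 1%:M 0 c 1%:M = (aff c^T 1%:M)^T.
    by rewrite /aff tr_block_mx !tr_scalar_mx trmxK trmx0.
  apply: (@aff1_ind_transvec m (fun A => P A^T)) => [|p q npq|B C PB PC].
  - by rewrite tr_scalar_mx.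
  - by rewrite raddfD /= tr_scalar_mx trmx_delta; apply: (Pt); rewrite eq_sym.
  - by rewrite trmx_mul; apply: (PM).
have P00 (B : 'M[_]_(1 + m)) : B \in unitmx -> ulsubmx B = 1%:M -> P B.
  move=> uB B1; set c := dlsubmx B; set x := ursubmx B.
  pose h := drsubmx B - c *m x.
  have BE : B = block_mx 1%:M 0 c 1%:M *m aff x h.
    rewrite /aff mulmx_block !mul1mx !mul0mx !mulmx1 !addr0.
    by rewrite addrC /h subrK -B1 submxK.
  have uh : h \in unitmx.
    by move: uB; rewrite BE unitmx_mul aff_unit => /andP[].
  rewrite BE affE; apply: (PM) => //; apply: (PM) => //.
  apply: (IH (fun h => P (aff 0 h))) uh.
  - by rewrite aff01.
  - move=> p q npq; rewrite (_ : aff 0 _ = 1%:M + delta_mx (rshift 1 p) (rshift 1 q)).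
      by apply: (Pt); apply: contraNN npq => /eqP/(@rshift_inj 1 m) ->.
    by rewrite (delta_block p q) -[X in _ = X + _]aff01 /aff add_block_mx !addr0.
  - by move=> C D PC PD; rewrite -[0](addr0 0) -[X in _ + X](mul0mx _ D) -affM; apply: (PM).
move=> uA; pose a := (A : 'M[_]_(1 + m)) (lshift m 0) (lshift m 0).
have ulE (B : 'M['F_2]_(1 + m)) : B (lshift m 0) (lshift m 0) = 1 -> ulsubmx B = 1%:M.
  by move=> B1; apply/matrixP=> i j; rewrite !ord1 !mxE B1.
have [a0|a1] := F2_cases a; last by apply: P00 => //; apply: ulE.
have [p Ap] : exists p, (A : 'M[_]_(1 + m)) (rshift 1 p) (lshift m 0) != 0.
  apply/existsP; apply: contraT; rewrite negb_exists => /forallP A0.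
  have A00 : (A : 'M[_]_(1 + m)) *m delta_mx (lshift m 0) (0 : 'I_1) = 0.
    rewrite -colE; apply/matrixP=> i j; rewrite !mxE.
    case: (split_ordP i) => k ->; first by rewrite !ord1.
    by apply/eqP; move: (A0 k); rewrite negbK.
  have /matrixP/(_ (lshift m 0) 0) : delta_mx (lshift m 0) (0 : 'I_1) = 0 :> 'cV['F_2]_(1 + m).
    by rewrite -(mulKmx uA (delta_mx _ _)) A00 mulmx0.
  by rewrite !mxE !eqxx.
pose T : 'M['F_2]_(1 + m) := 1%:M + delta_mx (lshift m 0) (rshift 1 p).
have TT : T *m T = 1%:M by apply: F2_transvecK.
have uT : T \in unitmx by case: (mulmx1_unit TT).
rewrite -[A]mul1mx -TT -mulmxA; apply: (PM); first exact: (Pt).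
apply: P00; first by rewrite unitmx_mul uT.
apply: ulE; rewrite mulmxDl mul1mx mxE -/a a0 add0r mxE (bigD1 (rshift 1 p)) //= big1.
  by rewrite addr0 !mxE !eqxx mul1r (F2_neq0 Ap).
by move=> k kp; rewrite !mxE (negPf kp) andbF mul0r.
Qed.

Lemma mulmx_unit_eq0 (R : comUnitRingType) n p (A : 'M[R]_n) (B : 'M[_]_(n, p)) :
  A \in unitmx -> A *m B = 0 -> B = 0.
Proof. by move=> uA AB0; rewrite -(mulKmx uA B) AB0 mulmx0. Qed.

Lemma pid_mx1_delta m : pid_mx 1 = delta_mx ord0 0 :> 'cV['F_2]_(1 + m).
Proof. by apply/matrixP=> i j; rewrite !mxE ord1 andbT; case: i => -[|i] hi. Qed.

Lemma pid_mx1_col m : pid_mx 1 = col_mx 1%:M 0 :> 'cV['F_2]_(1 + m).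
Proof.
apply/matrixP=> i j; rewrite !mxE; case: splitP => k ->; rewrite !ord1 ?mxE //.
Qed.

Lemma F2_mx11 (A : 'M['F_2]_1) : A \in unitmx -> A = 1%:M.
Proof.
rewrite unitmxE det_mx11 => uA; apply/matrixP=> i j; rewrite !ord1 mxE eqxx.
by apply: F2_neq0; rewrite -unitfE.
Qed.

(* A nonzero column of the form L *m pid_mx 1 *m U with U = 1 is the image of
   the first basis vector by the extended column basis L. *)
Lemma F2_col_transitive m (c : 'cV['F_2]_m) :
  c != 0 -> exists2 g : 'M[_]_m, g \in unitmx & g *m pid_mx 1 = c.
Proof.
move=> c0; exists (col_ebase c); first exact: col_ebase_unit.
have rc : \rank c = 1.
  by apply/eqP; rewrite eqn_leq rank_leq_col lt0n mxrank_eq0.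
rewrite -[RHS]mulmx_ebase rc.
by rewrite (F2_mx11 (row_ebase_unit c)) mulmx1.
Qed.

Definition unitriangular m (u : 'M['F_2]_m) :=
  forall p q : 'I_m, (q <= p)%N -> u p q = (p == q)%:R.

Lemma unitriangular_unit m (u : 'M['F_2]_m) : unitriangular u -> u \in unitmx.
Proof.
move=> Hu; rewrite -unitmx_tr unitmxE det_trig.
  by rewrite big1 ?unitr1 // => i _; rewrite mxE Hu ?eqxx.
by apply/is_trig_mxP => i j ij; rewrite mxE Hu ?(ltnW ij) // eq_sym -val_eqE ltn_eqF.
Qed.

Lemma F2_clear_col m (c : 'cV['F_2]_m) : c != 0 ->
  exists w, exists2 u, unitriangular u & u *m c = delta_mx w 0.
Proof.
move=> c0; have [k ck] : exists k, c k 0 != 0.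
  apply/existsP; apply: contraNT c0; rewrite negb_exists => /forallP c0.
  by apply/eqP/matrixP=> i j; rewrite ord1 mxE; apply/eqP; move: (c0 i); rewrite negbK.
(* The pivot w is the lowest nonzero entry of c, so that only entries above it are cleared and u is
   upper triangular. *)
case: (@arg_maxnP _ k (fun k => c k 0 != 0) (fun k => k : nat) ck) => w cw wmax.
exists w; exists (1%:M - (c - delta_mx w 0) *m delta_mx 0 w).
  move=> p q qp; rewrite !mxE big_ord1 !mxE eqxx /=.
  suff: (c p 0 - (p == w)%:R) * (q == w)%:R = 0 by rewrite andbT => ->; rewrite subr0.
  case: (altP (q =P w)) => [qw|_]; last by rewrite mulr0.
  rewrite mulr1; case: (altP (p =P w)) => [->|pw].
    by rewrite (F2_neq0 cw) subrr.
  rewrite subr0; apply/eqP; apply: contraNT pw => cp.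
  by rewrite -val_eqE eqn_leq (wmax p cp : (p <= w)%N) -qw qp.
rewrite mulmxBl mul1mx -mulmxA -rowE.
rewrite (_ : row w c = 1%:M) ?mulmx1 ?subKr //.
by apply/matrixP=> i j; rewrite !ord1 !mxE eqxx (F2_neq0 cw).
Qed.

(** Moves the first basis vector to position w and keeps the others in increasing order; hence
    conjugation by it turns unitriangular matrices of the last m coordinates into unitriangular
    ones. *)
Definition sigma m (w : 'I_m.+1) : 'M['F_2]_(1 + m) := perm_mx (lift_perm w ord0 1).

Lemma sigma_unit m (w : 'I_m.+1) : sigma w \in unitmx.
Proof. exact: unitmx_perm. Qed.

Lemma sigma_pid m (w : 'I_m.+1) : sigma w *m pid_mx 1 = delta_mx w 0 :> 'cV_(1 + m).
Proof.
rewrite pid_mx1_delta -row_permE; apply/matrixP=> i j; rewrite !mxE.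
by rewrite -[X in _ == X](lift_perm_id w ord0 (1 : 'S_m)) (inj_eq perm_inj).
Qed.

Lemma sigma_unitriangular m (w : 'I_m.+1) (u : 'M[_]_m) :
  unitriangular u -> unitriangular (sigma w *m aff 0 u *m invmx (sigma w)).
Proof.
move=> Hu p q; have -> : invmx (sigma w) = perm_mx (lift_perm w ord0 (1 : 'S_m))^-1%g by rewrite perm_mxV.
rewrite /sigma -row_permE -col_permE => qp; rewrite 2![LHS]mxE.
have l0 (x : 'I_m) : lift ord0 x = rshift 1 x by apply: val_inj.
have z0 : ord0 = lshift m 0 :> 'I_(1 + m) by apply: val_inj.
move: qp; case: (unliftP w p) => [p'|] ->; case: (unliftP w q) => [q'|] ->.
all: rewrite /aff ?lift_perm_id ?lift_perm_lift ?perm1 ?l0 ?z0 => qp.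
- by rewrite (inj_eq lift_inj) block_mxEdr Hu // -(leq_bump2 w).
- by rewrite block_mxEdl mxE eq_sym (negPf (neq_lift _ _)).
- by rewrite block_mxEur mxE (negPf (neq_lift _ _)).
- by rewrite block_mxEul mxE !eqxx.
Qed.

Lemma aff_of_col m (g : 'M['F_2]_(1 + m)) : g *m pid_mx 1 = pid_mx 1 :> 'cV_(1 + m) ->
  g = aff (ursubmx g) (drsubmx g).
Proof.
move=> ge; rewrite /aff -[LHS]submxK; move: ge.
rewrite -{1}[g]submxK pid_mx1_col mul_block_col !mulmx1 !mulmx0 !addr0.
by case/eq_col_mx => -> ->.
Qed.

(** One level of the Bruhat decomposition: once u has cleared the first column to a basis vector and
    [sigma w] has moved that vector to the front, the remaining matrix fixes the first basis column
    and so is affine. *)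
Lemma bruhat_step m (g : 'M['F_2]_(1 + m)) : g \in unitmx ->
  exists w u x h, [/\ unitriangular u, h \in unitmx &
    u *m g = sigma w *m aff 0 h *m aff x 1%:M].
Proof.
move=> ug; have [] := @F2_clear_col _ (g *m pid_mx 1).
  apply/eqP => /(mulmx_unit_eq0 ug)/matrixP/(_ ord0 0).
  by rewrite pid_mx1_delta !mxE !eqxx.
move=> w [u Hu]; rewrite mulmxA -sigma_pid => E.
pose g' := invmx (sigma w) *m (u *m g).
have g'e : g' *m pid_mx 1 = pid_mx 1 :> 'cV_(1 + m).
  by rewrite -mulmxA E mulKmx ?sigma_unit.
have g'E := aff_of_col g'e.
exists w, u, (ursubmx g'), (drsubmx g'); rewrite -mulmxA -affE -g'E mulKVmx ?sigma_unit //.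
split=> //; rewrite -(aff_unit (ursubmx g')) -g'E !unitmx_mul ug unitmx_inv sigma_unit /=.
by rewrite unitriangular_unit.
Qed.

(** * Equivariant functions on GL_m(F_2) *)

Definition sgF2 (K : pzRingType) (z : 'F_2) : K := if z == 0 then 1 else -1.

Lemma sgF2_0 (K : pzRingType) : sgF2 K 0 = 1.
Proof. by rewrite /sgF2 eqxx. Qed.

Lemma sgF2_D (K : pzRingType) a b : sgF2 K (a + b) = sgF2 K a * sgF2 K b.
Proof.
by case: (F2_cases a) => ->; case: (F2_cases b) => ->; rewrite /sgF2 /= ?mulrNN !(mulr1, mul1r).
Qed.

Lemma sgF2_sqr (K : pzRingType) a : sgF2 K a * sgF2 K a = 1.
Proof. by rewrite /sgF2; case: ifP => _; rewrite ?mulrNN mulr1. Qed.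

Definition chi (K : pzRingType) m (c : 'cV['F_2]_m) (x : 'rV['F_2]_m) : K :=
  sgF2 K ((x *m c) 0 0).

(** GL_m has two orbits on the characters of the row group, the trivial one and all others; these
    are their representatives, so one bit records an orbit. *)
Definition bit_col m (b : bool) : 'cV['F_2]_m := if b then pid_mx 1 else 0.

(* Right equivariance of type [b] : at each level, the first row of the current
   GL acts through the character selected by the next bit, and the GL
   remaining after [size b] levels acts trivially. *)
Fixpoint rtype (K : pzRingType) (V : lmodType K) (b : seq bool) (m : nat) :
    ('M['F_2]_m -> V) -> Prop :=
  match b with
  | [::] => fun F => forall g h, g \in unitmx -> h \in unitmx -> F (g *m h) = F g
  | b0 :: b' =>
    match m with
    | 0 => fun _ => True
    | m'.+1 => fun F =>
      (forall g x, g \in unitmx ->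
        F (g *m aff x 1%:M) = chi K (bit_col m' b0) x *: F g) /\
      (forall g, g \in unitmx -> @rtype K V b' m' (fun h => F (g *m aff 0 h)))
    end
  end.

Lemma rtype_eq (K : pzRingType) (V : lmodType K) b m (F F' : 'M['F_2]_m -> V) :
  (forall g, g \in unitmx -> F g = F' g) -> rtype b F -> rtype b F'.
Proof.
elim: b m F F' => [|b0 b IH] [|m] F F' E //= HF.
- by move=> g h ug uh; rewrite -!E ?unitmx_mul ?ug // HF.
- by move=> g h ug uh; rewrite -!E ?unitmx_mul ?ug // HF.
case: HF => H1 H2; split=> [g x ug|g ug].
  by rewrite -!E ?unitmx_mul ?ug ?aff_unit ?unitmx1 // H1.
apply: IH (H2 g ug) => h uh; apply: E.
by rewrite unitmx_mul ug aff_unit.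
Qed.

(** Representatives of the Bruhat double cosets seen by a function of right type of length j: at
    most m^j of them, against the order of GL_m. *)
Fixpoint test_points (j m : nat) : seq 'M['F_2]_m :=
  match j with
  | 0 => [:: 1%:M]
  | j'.+1 =>
    match m with
    | 0 => [:: 1%:M]
    | m'.+1 => [seq sigma w *m aff 0 h | w <- enum 'I_m'.+1, h <- test_points j' m']
    end
  end.

Lemma size_test_points j m M : (m <= M)%N -> (0 < M)%N -> (size (test_points j m) <= M ^ j)%N.
Proof.
elim: j m => [|j IH] [|m] //= mM M0; first by rewrite expn_gt0 M0.
by rewrite size_allpairs size_enum_ord expnS leq_mul // IH // ltnW.
Qed.

Lemma test_points_unit j m g : g \in test_points j m -> g \in unitmx.
Proof.
elim: j m g => [|j IH] [|m] g /=; try by rewrite inE => /eqP ->; exact: unitmx1.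
case/allpairsP => -[w h] [_ /= /IH uh ->].
by rewrite unitmx_mul sigma_unit aff_unit.
Qed.

(** Each level is peeled off by [bruhat_step]: the row factor is a scalar by right equivariance, u
    is absorbed on the left, and the rest is a smaller GL behind [sigma w]. On the left only
    vanishing has to propagate; this condition is inherited by the smaller function through
    conjugation by [sigma w]. *)
Lemma rtype_determined (K : pzRingType) (V : lmodType K) b m (F : 'M['F_2]_m -> V) :
  rtype b F ->
  (forall u g, unitriangular u -> g \in unitmx -> F (u *m g) = 0 -> F g = 0) ->
  (forall g, g \in test_points (size b) m -> F g = 0) ->
  forall g, g \in unitmx -> F g = 0.
Proof.
elim: b m F => [|b0 b IH] [|m] F /= Fr Fl F0 g ug.
- by rewrite (_ : g = 1%:M) ?F0 ?inE // [LHS]flatmx0 [RHS]flatmx0.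
- by rewrite -[g]mul1mx Fr ?unitmx1 // F0 ?inE.
- by rewrite (_ : g = 1%:M) ?F0 ?inE // [LHS]flatmx0 [RHS]flatmx0.
have [w [u [x [h [Hu uh E]]]]] := bruhat_step ug.
apply: (Fl u) => //; rewrite E; case: Fr => -> => [Fr|]; last first.
  by rewrite unitmx_mul sigma_unit aff_unit.
suff -> : F (sigma w *m aff 0 h) = 0 by rewrite scaler0.
apply: (IH m (fun h => F (sigma w *m aff 0 h))) uh.
- exact: (Fr _ (sigma_unit w)).
- move=> v k Hv uk Fvk; apply: (Fl _ _ (sigma_unitriangular w Hv)).
    by rewrite unitmx_mul sigma_unit aff_unit.
  rewrite mulmxA mulmxKV ?sigma_unit // -mulmxA affM mul0mx addr0; exact: Fvk.
- move=> k hk; apply: F0; apply/allpairsP; exists (w, k); split=> //=.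
  by rewrite mem_enum.
Qed.

(** * Characters of the first row group *)

Section Characters.
Variable K : numFieldType.

Lemma chi0x m x : chi K (0 : 'cV_m) x = 1.
Proof. by rewrite /chi mulmx0 mxE sgF2_0. Qed.

Lemma chi_sqr m (c : 'cV_m) x : chi K c x * chi K c x = 1.
Proof. exact: sgF2_sqr. Qed.

Lemma chiDr m (c : 'cV_m) x y : chi K c (x + y) = chi K c x * chi K c y.
Proof. by rewrite /chi mulmxDl mxE sgF2_D. Qed.

Lemma chiDl m (c d : 'cV_m) x : chi K (c + d) x = chi K c x * chi K d x.
Proof. by rewrite /chi mulmxDr mxE sgF2_D. Qed.

Lemma chi_tr m (c : 'cV_m) x : chi K c x = chi K x^T c^T.
Proof. by rewrite /chi -trmx_mul [_^T 0 0]mxE. Qed.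

Lemma chi_mulmx m (h : 'M[_]_m) c x : chi K c (x *m h) = chi K (h *m c) x.
Proof. by rewrite /chi mulmxA. Qed.

Lemma sum_chi m (c : 'cV_m) : \sum_x chi K c x = (2 ^ m)%:R * (c == 0)%:R.
Proof.
case: eqP => [->|/eqP c0].
  under eq_bigr do rewrite chi0x.
  by rewrite sumr_const card_mx card_Fp // mul1n mulr1.
rewrite mulr0; have [k ck] : exists k, c k 0 != 0.
  apply/existsP; apply: contraNT c0; rewrite negb_exists => /forallP c0.
  by apply/eqP/matrixP=> i j; rewrite ord1 mxE; apply/eqP; move: (c0 i); rewrite negbK.
have cy : chi K c (delta_mx 0 k) = -1 by rewrite /chi -rowE mxE /sgF2 (negPf ck).
have: \sum_x chi K c x = - \sum_x chi K c x.
  rewrite [LHS](reindex_inj (addIr (delta_mx 0 k))) -sumrN; apply: eq_bigr => x _.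
  by rewrite chiDr cy mulrN1.
by move/eqP; rewrite -subr_eq0 opprK -mulr2n mulrn_eq0 => /eqP.
Qed.

Lemma sum_chi_dual m (x : 'rV_m) : \sum_c chi K c x = (2 ^ m)%:R * (x == 0)%:R.
Proof.
rewrite (eq_bigr (fun c => chi K x^T c^T)) => [|c _]; last exact: chi_tr.
rewrite (reindex (@trmx _ 1 m)) /=; last by apply: onW_bij; exists trmx; exact: trmxK.
under eq_bigr do rewrite trmxK.
by rewrite sum_chi trmx_eq0.
Qed.
End Characters.

(** * Weight spaces of the first row group *)

Section Weights.
Variables (K : numFieldType) (m n : nat).
Implicit Types (rho : 'M['F_2]_(1 + m) -> 'M[K]_n) (W : 'M[K]_n).

(** Multiplicativity on the affine group only: once a nontrivial character is fixed, the weight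
    space is preserved by the stabilizer of that character, not by the whole GL. *)
Definition affhom rho := rho 1%:M = 1%:M /\
  forall x y h k, h \in unitmx -> k \in unitmx ->
    rho (aff x h *m aff y k) = rho (aff x h) *m rho (aff y k).

Definition affstable W rho := forall x h, h \in unitmx -> stablemx W (rho (aff x h)).

Definition rowwt rho (c : 'cV_m) : 'M[_]_n :=
  (\bigcap_x eigenspace (rho (aff x 1%:M)) (chi K c x))%MS.

(** Fourier projector onto the weight space; the characters take values 1 and -1, so each is its own
    inverse. *)
Definition proj_rowwt rho (c : 'cV_m) : 'M[_]_n :=
  (2 ^ m)%:R^-1 *: \sum_x chi K c x *: rho (aff x 1%:M).

Lemma rowwtP rho c p (v : 'M[_]_(p, n)) :
  reflect (forall x, v *m rho (aff x 1%:M) = chi K c x *: v) (v <= rowwt rho c)%MS.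
Proof.
apply: (iffP sub_bigcapmxP) => H x; first by apply/eigenspaceP/H.
by move=> _; apply/eigenspaceP/H.
Qed.

Let two_m0 : (2 ^ m)%:R != 0 :> K.
Proof. by rewrite pnatr_eq0 expn_eq0. Qed.

Lemma proj_rowwt_sum rho : affhom rho -> \sum_c proj_rowwt rho c = 1%:M.
Proof.
case=> r1 _; rewrite -scaler_sumr exchange_big /=.
rewrite (eq_bigr (fun x => ((2 ^ m)%:R * (x == 0)%:R) *: rho (aff x 1%:M))); last first.
  by move=> x _; rewrite -scaler_suml sum_chi_dual.
rewrite (bigD1 0) //= eqxx aff01 r1 big1 => [|x /negPf ->]; last by rewrite mulr0 scale0r.
by rewrite mulr1 addr0 scalerA mulVf // scale1r.
Qed.

Lemma proj_rowwt_in rho W c p (v : 'M[_]_(p, n)) : affhom rho -> affstable W rho ->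
  (v <= W)%MS -> (v *m proj_rowwt rho c <= W :&: rowwt rho c)%MS.
Proof.
move=> [r1 rM] sW vW; rewrite sub_capmx; apply/andP; split.
  rewrite /proj_rowwt -scalemxAr scalemx_sub // mulmx_sumr summx_sub // => x _.
  by rewrite -scalemxAr scalemx_sub // (submx_trans (submxMr _ vW)) // sW ?unitmx1.
apply/rowwtP => y; rewrite /proj_rowwt -!scalemxAr -!scalemxAl [RHS]scalerA [_ * (_^-1)]mulrC.
rewrite -scalerA; congr (_ *: _); rewrite scalemxAr -mulmxA; congr (_ *m _).
rewrite mulmx_suml scaler_sumr [RHS](reindex_inj (addIr y)) /=; apply: eq_bigr => x _.
rewrite -scalemxAl -rM ?unitmx1 // -affD scalerA chiDr; congr (_ *: _).
by rewrite mulrCA chi_sqr mulr1.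
Qed.

Lemma proj_rowwt_id rho c d p (v : 'M[_]_(p, n)) : (v <= rowwt rho c)%MS ->
  v *m proj_rowwt rho d = (c == d)%:R *: v.
Proof.
move/rowwtP => Hv; rewrite /proj_rowwt -scalemxAr mulmx_sumr.
under eq_bigr do rewrite -scalemxAr Hv scalerA -chiDl.
rewrite -scaler_suml sum_chi scalerA mulrA mulVf // mul1r.
by rewrite -[d in d + c](F2mx_oppr d) addrC subr_eq0.
Qed.

Lemma rank_rowwt_sum rho W :
  (\sum_c \rank (W :&: rowwt rho c)%MS <= \rank W)%N.
Proof.
suff /mxdirectP /= <- : mxdirect (\sum_c (W :&: rowwt rho c))%MS.
  by apply: mxrankS; apply/sumsmx_subP => c _; exact: capmxSl.
apply/mxdirect_sumsP => c _; apply/eqP/rowV0P => v; rewrite sub_capmx => /andP[vc].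
case/sub_sumsmxP => u vE.
have {vc}vc : (v <= rowwt rho c)%MS by apply: submx_trans vc (capmxSr _ _).
have := proj_rowwt_id c vc; rewrite eqxx scale1r => <-.
rewrite vE mulmx_suml big1 // => d /andP[_ dc].
rewrite (@proj_rowwt_id _ d) ?(negPf dc) ?scale0r //.
by apply: submx_trans (submxMl _ _) (capmxSr _ _).
Qed.

Lemma affhom_unit rho x h : affhom rho -> h \in unitmx -> rho (aff x h) \in unitmx.
Proof.
case=> r1 rM uh.
suff /mulmx1_unit[] : rho (aff x h) *m rho (aff (x *m invmx h) (invmx h)) = 1%:M by [].
by rewrite -rM ?unitmx_inv // affM mulmxV // F2mx_addrr aff01.
Qed.

(** The identity [aff x h = aff (x *m invmx h) 1%:M *m aff 0 h] shows that the complement GL_m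
    permutes the weight spaces as it permutes characters. *)
Lemma rowwt_transport rho W c h : affhom rho -> affstable W rho -> h \in unitmx ->
  ((W :&: rowwt rho (h *m c)) *m rho (aff 0 h) <= W :&: rowwt rho c)%MS.
Proof.
move=> [r1 rM] sW uh; rewrite sub_capmx; apply/andP; split.
  by apply: submx_trans (submxMr _ (capmxSl _ _)) (sW _ _ uh).
apply/rowwtP => x; set A := (W :&: _)%MS.
have /rowwtP HA : (A <= rowwt rho (h *m c))%MS by exact: capmxSr.
rewrite -mulmxA -rM ?unitmx1 // affM mul0mx addr0 mulmx1.
have -> : aff x h = aff (x *m invmx h) 1%:M *m aff 0 h.
  by rewrite affM mulmxKV // add0r mul1mx.
rewrite rM ?unitmx1 // mulmxA HA -scalemxAl -chi_mulmx mulmxKV //.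
Qed.

Lemma rank_rowwt_eq rho W c d : affhom rho -> affstable W rho -> c != 0 -> d != 0 ->
  (\rank (W :&: rowwt rho c)%MS <= \rank (W :&: rowwt rho d)%MS)%N.
Proof.
move=> hr sW /F2_col_transitive[g ug <-] /F2_col_transitive[h uh <-].
have fX : row_free (rho (aff 0 (g *m invmx h))).
  by rewrite row_free_unit affhom_unit // unitmx_mul ug unitmx_inv.
apply: leq_trans (eq_leq (esym (mxrankMfree _ fX))) _.
apply/mxrankS; rewrite -[g in g *m pid_mx 1](mulmxKV uh) -mulmxA.
by apply: rowwt_transport; rewrite // unitmx_mul ug unitmx_inv.
Qed.

(** If one nontrivial weight occurs in W, transitivity of GL_m on nonzero columns makes all 2^m - 1
    of them occur with equal rank, and their sum is direct. *)
Lemma rowwt_dichotomy rho W : affhom rho -> affstable W rho -> W != 0 ->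
  (forall x, W *m rho (aff x 1%:M) = W) \/
  [/\ (0 < m)%N, (0 < \rank (W :&: rowwt rho (pid_mx 1))%MS)%N &
      ((2 ^ m).-1 * \rank (W :&: rowwt rho (pid_mx 1))%MS <= \rank W)%N].
Proof.
move=> hr sW W0.
have [/existsP[c /andP[c0 wc]]|/existsPn none] :=
  boolP [exists c, (c != 0) && (W :&: rowwt rho c != 0)%MS]; [right|left].
  have m0 : (0 < m)%N.
    rewrite lt0n; apply: contraNN c0 => /eqP m0; apply/eqP/matrixP => i.
    by have := ltn_ord i; rewrite [X in (_ < X)%N]m0.
  have p0 : pid_mx 1 != 0 :> 'cV['F_2]_m.
    case: (m) m0 => // k _; rewrite pid_mx1_delta; apply/eqP => /matrixP/(_ ord0 0).
    by rewrite !mxE !eqxx.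
  split=> //.
    apply: leq_trans (rank_rowwt_eq hr sW c0 p0).
    by rewrite lt0n mxrank_eq0.
  apply: leq_trans (rank_rowwt_sum rho W); rewrite (bigD1 0) //=.
  apply: leq_trans (leq_addl _ _).
  set r := \rank _; have -> : ((2 ^ m).-1 * r = \sum_(c : 'cV['F_2]_m | (c != 0)%R) r)%N.
    rewrite sum_nat_const; congr (_ * _)%N.
    by rewrite -[RHS]/(#|predC1 (0 : 'cV['F_2]_m)|) cardC1 card_mx card_Fp // muln1.
  by apply: leq_sum => d d0; exact: rank_rowwt_eq.
(* No nontrivial weight occurs, so only the trivial term survives in the decomposition of the
   identity into projectors. *)
have W0E : W = W *m proj_rowwt rho 0.
  rewrite -[LHS]mulmx1 -(proj_rowwt_sum hr) mulmx_sumr (bigD1 0) //= big1 ?addr0 // => c c0.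
  have := none c; rewrite c0 /= negbK => /eqP w0; apply/eqP.
  by rewrite -submx0 -w0; exact: proj_rowwt_in.
have /rowwtP H : (W <= rowwt rho 0)%MS.
  by rewrite W0E; apply: submx_trans (proj_rowwt_in _ hr sW (submx_refl W)) (capmxSr _ _).
by move=> x; rewrite H chi0x scale1r.
Qed.
End Weights.

(** * Chains of characters *)

Definition unithom (K : numFieldType) m n (rho : 'M['F_2]_m -> 'M[K]_n) :=
  rho 1%:M = 1%:M /\
  forall g h, g \in unitmx -> h \in unitmx -> rho (g *m h) = rho g *m rho h.

(** The vector side of [rtype]: at each level the row group acts by the character of the next bit,
    and the GL left after the last bit acts trivially. *)
Fixpoint eigsp (K : numFieldType) n (b : seq bool) (m : nat) :
    ('M['F_2]_m -> 'M[K]_n) -> 'M[K]_n :=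
  match b with
  | [::] => fun rho => (\bigcap_(g | g \in unitmx) eigenspace (rho g) 1)%MS
  | b0 :: b' =>
    match m with
    | 0 => fun _ => 1%:M
    | m'.+1 => fun rho =>
      (rowwt rho (bit_col m' b0) :&: @eigsp K n b' m' (fun g => rho (aff 0 g)))%MS
    end
  end.

Section Chain.
Variables (K : numFieldType).

Lemma unithom_affhom m n (rho : 'M['F_2]_(1 + m) -> 'M[K]_n) : unithom rho -> affhom rho.
Proof. by case=> r1 rM; split=> // x y h k uh uk; rewrite rM ?aff_unit. Qed.

Lemma affhom_unithom m n (rho : 'M['F_2]_(1 + m) -> 'M[K]_n) :
  affhom rho -> unithom (fun g => rho (aff 0 g)).
Proof.
case=> r1 rM; split=> [|g h ug uh]; first by rewrite aff01.
by rewrite -rM // affM mul0mx addr0.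
Qed.

Lemma unithom_unit m n (rho : 'M['F_2]_m -> 'M[K]_n) g :
  unithom rho -> g \in unitmx -> rho g \in unitmx.
Proof.
case=> r1 rM ug.
suff /mulmx1_unit[] : rho g *m rho (invmx g) = 1%:M by [].
by rewrite -rM ?unitmx_inv // mulmxV.
Qed.

(* 1 + E_pq is conjugate to [aff x 1] by any g mapping the first basis vector
   to e_p, the row x being row q of g. *)
Lemma F2_transvec_conj m (p q : 'I_(1 + m)) : p != q ->
  exists2 g : 'M['F_2]_(1 + m), g \in unitmx &
    exists x, (1%:M + delta_mx p q) *m g = g *m aff x 1%:M.
Proof.
move=> pq; have [] := @F2_col_transitive (1 + m) (delta_mx p 0).
  by apply/eqP => /matrixP/(_ p 0); rewrite !mxE !eqxx.
move=> g ug ge; exists g => //; exists (rsubmx (row q g)).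
have -> : aff (rsubmx (row q g)) 1%:M = 1%:M + pid_mx 1 *m row q g.
  rewrite pid_mx1_col mul_col_mx mul1mx mul0mx -aff01 /aff -[in RHS](hsubmxK (row q g)).
  have -> : lsubmx (row q g) = 0.
    move/matrixP/(_ q 0): ge; rewrite pid_mx1_delta -colE !mxE [_ && _](_ : _ = false).
      by move=> g0; apply/matrixP => i j; rewrite !ord1 !mxE; apply: etrans g0; congr (g _ _); apply: val_inj.
    by rewrite eq_sym (negPf pq).
  by rewrite /block_mx add_col_mx !add_row_mx !addr0 add0r.
rewrite mulmxDl mul1mx mulmxDr mulmx1 mulmxA ge; congr (_ + _).
by rewrite rowE mulmxA mul_delta_mx.
Qed.

(** Transvections generate, and each is conjugate to a first row element. If t g = g r with r in the
    row group, then W g lies in W, where r acts trivially, so t acts trivially on W after cancelling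
    g. *)
Lemma unithom_trivial m n (rho : 'M['F_2]_(1 + m) -> 'M[K]_n) (W : 'M[_]_n) :
  unithom rho -> (forall g, g \in unitmx -> stablemx W (rho g)) ->
  (forall x, W *m rho (aff x 1%:M) = W) ->
  forall g, g \in unitmx -> W *m rho g = W.
Proof.
move=> hr sW HW g ug.
suff [] : g \in unitmx /\ W *m rho g = W by [].
move: {ug}g (ug); apply: unitmx_ind_transvec => [|p q pq|g h [ug Wg] [uh Wh]].
- by rewrite unitmx1; case: hr => -> _; rewrite mulmx1.
- have ut : 1%:M + delta_mx p q \in @unitmx 'F_2 (1 + m).
    by have [] := mulmx1_unit (F2_transvecK pq).
  split=> //; have [g ug [x E]] := F2_transvec_conj pq.
  have [r1 rM] := hr.
  have Wg_sub : (W <= W *m rho g)%MS.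
    have : (W *m rho (invmx g) <= W)%MS by apply: sW; rewrite unitmx_inv.
    move/(submxMr (rho g)); rewrite -mulmxA -rM ?unitmx_inv // mulVmx // r1 mulmx1.
    exact.
  suff H : W *m rho (1%:M + delta_mx p q) *m rho g = W *m rho g.
    by move/(congr1 (fun A => A *m invmx (rho g))): H; rewrite !mulmxK ?unithom_unit.
  rewrite -mulmxA -rM // E rM ?aff_unit ?unitmx1 // mulmxA.
  have /submxP[D ->] : (W *m rho g <= W)%MS by exact: sW.
  by rewrite -mulmxA HW.
- split; first by rewrite unitmx_mul ug.
  by case: hr => _ ->; rewrite // mulmxA Wg Wh.
Qed.

(* [j] steps in GL_m use at least [j/2] nontrivial characters, each multiplying
   the dimension by [2^k - 1 >= 2^(k-1)] with k = m - 1, m - 3, ...; whence the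
   quadratic bound [j (2m - j - 2) <= 4E]. *)
Definition chain_goal n m (rho : 'M['F_2]_m -> 'M[K]_n) (W : 'M[_]_n) b E :=
  (0 < \rank (W :&: eigsp b rho)%MS)%N /\
  (2 ^ E * \rank (W :&: eigsp b rho)%MS <= \rank W)%N.

Lemma pow2_pred_mul r s m : ((2 ^ m.+1).-1 * r <= s -> 2 ^ m * r <= s)%N.
Proof.
apply: leq_trans; rewrite leq_mul2r; apply/orP; right.
by rewrite expnS; have := expn_gt0 2 m; lia.
Qed.

Lemma chain_step n m (rho : 'M['F_2]_(1 + (1 + m)) -> 'M[K]_n) (W : 'M[_]_n) b E :
  let W1 := (W :&: rowwt rho (bit_col (1 + m) true))%MS in
  ((2 ^ m.+1).-1 * \rank W1 <= \rank W)%N ->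
  chain_goal (fun g => rho (aff 0 g)) W1 b E -> chain_goal rho W (true :: b) (m + E).
Proof.
move=> W1 W1W [gt0 le]; rewrite /chain_goal /= capmxA; split=> //.
apply: leq_trans (pow2_pred_mul W1W).
by rewrite expnD -mulnA leq_mul2l le orbT.
Qed.

(** The stabilizer in GL_(1+m) of the chosen nontrivial character is again an affine group, so the
    chain can go on one level lower. *)
Lemma chain_stable n m (rho : 'M['F_2]_(1 + (1 + m)) -> 'M[K]_n) (W : 'M[_]_n) :
  affhom rho -> affstable W rho ->
  affstable (W :&: rowwt rho (bit_col (1 + m) true))%MS (fun g => rho (aff 0 g)).
Proof.
move=> hr sW x h uh; have uxh : aff x h \in unitmx by rewrite aff_unit.
have fix1 : aff x h *m bit_col (1 + m) true = bit_col (1 + m) true.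
  by rewrite /= pid_mx1_col /aff mul_block_col !mul1mx !mulmx0 !mul0mx !addr0.
by have := rowwt_transport (bit_col (1 + m) true) hr sW uxh; rewrite fix1.
Qed.

(** Joint induction on the two situations a chain meets. Under the full GL, a trivial row group
    forces a trivial action and ends the chain; otherwise the affine group of the next GL remains.
    Under an affine group, a trivial row group leaves a full GL at the price of one bit without
    gain, so no two such bits are consecutive. The affine statement therefore counts j, one less
    than the length. *)
Lemma chain_pair m :
  (forall n (rho : 'M['F_2]_m -> 'M[K]_n) W, unithom rho ->
     (forall g, g \in unitmx -> stablemx W (rho g)) -> W != 0 ->
     exists b E, [/\ chain_goal rho W b E, (size b <= m)%N &
       (size b * (2 * m) <= 4 * E + size b * size b + 2 * size b)%N]) /\
  (forall n (rho : 'M['F_2]_(1 + m) -> 'M[K]_n) W, affhom rho ->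
     affstable W rho -> W != 0 ->
     exists b E, exists2 j, (size b = j.+1) & [/\ chain_goal rho W b E, (j <= m)%N &
       (j * (2 * m) <= 4 * E + j * j + 2 * j)%N]).
Proof.
have triv m' n (rho : 'M['F_2]_m' -> 'M[K]_n) W : W != 0 ->
    (forall g, g \in unitmx -> W *m rho g = W) -> chain_goal rho W [::] 0.
  move=> W0 H; rewrite /chain_goal /=.
  suff /capmx_idPl -> : (W <= \bigcap_(g | g \in unitmx) eigenspace (rho g) 1)%MS.
    by rewrite lt0n mxrank_eq0 W0 mul1n.
  by apply/sub_bigcapmxP => g ug; apply/eigenspaceP; rewrite H // scale1r.
elim/ltn_ind: m => m IH.
have PA n (rho : 'M['F_2]_m -> 'M[K]_n) W : unithom rho ->
     (forall g, g \in unitmx -> stablemx W (rho g)) -> W != 0 ->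
     exists b E, [/\ chain_goal rho W b E, (size b <= m)%N &
       (size b * (2 * m) <= 4 * E + size b * size b + 2 * size b)%N].
  case: m IH rho => [|m] IH rho hr sW W0.
    exists [::], 0; split=> //; apply: triv => // g _.
    by rewrite (_ : g = 1%:M) ?(proj1 hr) ?mulmx1 // [LHS]flatmx0 [RHS]flatmx0.
  have har := unithom_affhom hr.
  have sa : affstable W rho by move=> x h uh; apply: sW; rewrite aff_unit.
  case: (rowwt_dichotomy har sa W0) => [H|].
    by exists [::], 0; split=> //; apply: triv => // g; exact: unithom_trivial.
  case: m IH rho hr sW W0 har sa => [|m] IH rho hr sW W0 har sa [] // _ W1 W1W.
  have h1 := unithom_affhom (affhom_unithom har).
  have [||b [E [j sb [G jm L]]]] := (IH m _).2 n _ _ h1 (chain_stable har sa) _.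
  - by lia.
  - by rewrite -mxrank_eq0 -lt0n.
  exists (true :: b), (m + E)%N; split; first exact: chain_step.
    by rewrite /= sb; lia.
  by rewrite /= sb; nia.
split=> // n rho W hr sW W0.
case: (rowwt_dichotomy hr sW W0) => [H|].
  have [||b [E [[G1 G2] bm L]]] := PA n (fun g => rho (aff 0 g)) W _ _ W0.
  - exact: affhom_unithom.
  - by move=> g ug; exact: sW.
  exists (false :: b), E, (size b) => //; split=> //.
  rewrite /chain_goal /= capmxA.
  suff /capmx_idPl WW : (W <= rowwt rho (bit_col m false))%MS.
    by rewrite (cap_eqmx WW (eqmx_refl _)).
  by apply/rowwtP => x; rewrite H chi0x scale1r.
case: m IH PA rho hr sW W0 => [|m] IH PA rho hr sW W0 [] // _ W1 W1W.
have h1 := unithom_affhom (affhom_unithom hr).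
have [||b [E [j sb [G jm L]]]] := (IH m _).2 n _ _ h1 (chain_stable hr sW) _.
- by lia.
- by rewrite -mxrank_eq0 -lt0n.
exists (true :: b), (m + E)%N, j.+1; first by rewrite /= sb.
split; [exact: chain_step|by lia|by nia].
Qed.

End Chain.

(** * Equivariance of matrix coefficients between eigenvectors *)

Section Eigsp.
Variables (K : numFieldType) (n : nat).

Lemma eigsp_eq b m (rho rho' : 'M['F_2]_m -> 'M[K]_n) :
  rho =1 rho' -> eigsp b rho = eigsp b rho'.
Proof.
elim: b m rho rho' => [|b0 b IH] [|m] rho rho' E //=.
- by apply: eq_bigr => g _; rewrite E.
- by apply: eq_bigr => g _; rewrite E.
congr (_ :&: _)%MS; first by apply: eq_bigr => x _; rewrite E.
by apply: IH => g; exact: E.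
Qed.

(** Allows chains for commuting groups to be nested: the eigenspace found for one group is preserved
    by the others. *)
Lemma eigsp_stable b m (rho : 'M['F_2]_m -> 'M[K]_n) X :
  (forall g, g \in unitmx -> rho g *m X = X *m rho g) -> stablemx (eigsp b rho) X.
Proof.
elim: b m rho => [|b0 b IH] m rho C.
  apply/sub_bigcapmxP => g ug; apply/eigenspaceP; rewrite -mulmxA -C // mulmxA.
  suff /eigenspaceP -> : (eigsp [::] rho <= eigenspace (rho g) 1)%MS by rewrite !scale1r.
  by rewrite /= (bigcapmx_inf g).
case: m rho C => [|m] rho C /=; first by rewrite submx_full // row_full_unit unitmx1.
rewrite sub_capmx; apply/andP; split.
  apply/rowwtP => x; rewrite -mulmxA -C ?aff_unit ?unitmx1 // mulmxA.
  set A := (_ :&: _)%MS; have /rowwtP -> : (A <= rowwt rho (bit_col m b0))%MS by exact: capmxSl.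
  by rewrite scalemxAl.
apply: submx_trans (submxMr _ (capmxSr _ _)) _.
by apply: IH => g ug; apply: C; rewrite aff_unit.
Qed.

(** The character through which unitriangular matrices act on [eigsp b]. *)
Fixpoint psi (b : seq bool) (m : nat) : 'M['F_2]_m -> K :=
  match b with
  | [::] => fun _ => 1
  | b0 :: b' =>
    match m with
    | 0 => fun _ => 1
    | m'.+1 => fun u : 'M[_]_(1 + m') =>
        chi K (bit_col m' b0) (ursubmx u) * @psi b' m' (drsubmx u)
    end
  end.

Lemma chi_neq0 m (c : 'cV_m) x : chi K c x != 0.
Proof. by apply: contraTneq (oner_neq0 K) => c0; rewrite -(chi_sqr K c x) c0 mulr0 eqxx. Qed.

Lemma psi_neq0 b m u : @psi b m u != 0.
Proof.
elim: b m u => [|b0 b IH] [|m] u /=; rewrite ?oner_neq0 //.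
by rewrite mulf_neq0 ?chi_neq0.
Qed.

Lemma unitriangular_aff m (u : 'M['F_2]_(1 + m)) : unitriangular u ->
  u = aff (ursubmx u) (drsubmx u) /\ unitriangular (drsubmx u).
Proof.
move=> Hu; split.
  rewrite /aff -[LHS]submxK; congr block_mx; apply/matrixP => i j; rewrite !mxE Hu ?ord1 //.
move=> p q qp; rewrite !mxE Hu; first by rewrite (inj_eq (@rshift_inj _ _)).
by rewrite /= leq_add2l.
Qed.

Lemma eigsp_left b m (rho : 'M['F_2]_m -> 'M[K]_n) p (v : 'M[_]_(p, n)) u :
  unithom rho -> (v <= eigsp b rho)%MS -> unitriangular u -> v *m rho u = psi b u *: v.
Proof.
elim: b m rho u => [|b0 b IH] m rho u hr.
  move=> vE Hu; rewrite [psi _ _]/=; apply/eigenspaceP; apply: submx_trans vE _.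
  by rewrite /= (bigcapmx_inf u) // unitriangular_unit.
case: m rho u hr => [|m] rho u hr.
  by rewrite (_ : u = 1%:M) ?(proj1 hr) ?mulmx1 ?scale1r // [LHS]flatmx0 [RHS]flatmx0.
rewrite /= sub_capmx => /andP[/rowwtP v1 v2] Hu; have [uE Hu'] := unitriangular_aff Hu.
have har := unithom_affhom hr.
rewrite {1}uE affE (proj2 hr) ?aff_unit ?unitmx1 ?unitriangular_unit // mulmxA.
by rewrite (IH _ _ _ (affhom_unithom har) v2 Hu') -scalemxAl v1 scalerA mulrC.
Qed.

Lemma invmx_aff0 m (g : 'M['F_2]_m) : invmx (aff 0 g) = aff 0 (invmx g).
Proof.
have [ug|ug] := boolP (g \in unitmx); last by rewrite !invmx_out ?inE ?aff_unit.
by rewrite /aff invmx_block_diag ?invmx1 //; move: (aff_unit 0 g); rewrite /aff => ->.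
Qed.

Definition dual_rep m (rho : 'M['F_2]_m -> 'M[K]_n) g := (rho (invmx g))^T.

Lemma dual_unithom m (rho : 'M['F_2]_m -> 'M[K]_n) : unithom rho -> unithom (dual_rep rho).
Proof.
case=> r1 rM; split=> [|g h ug uh]; rewrite /dual_rep ?invmx1 ?r1 ?trmx1 //.
have -> : invmx (g *m h) = invmx h *m invmx g.
  have ugh : g *m h \in unitmx by rewrite unitmx_mul ug.
  apply: (can_inj (mulKmx ugh)); rewrite mulmxV // -mulmxA (mulmxA h) mulmxV // mul1mx.
  by rewrite mulmxV.
by rewrite rM ?unitmx_inv // trmx_mul.
Qed.

(** Right translation of the coefficient acts on w, that is, through the dual on its transpose. Row
    elements are involutions over F_2, so the inverse in the dual does not change the character. The
    left factor A is arbitrary so that the recursion can absorb [rho g] into it. *)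
Lemma eigsp_dual_rtype b m (rho : 'M['F_2]_m -> 'M[K]_n) p (A : 'M[_]_(p, n)) (w : 'cV_n) :
  unithom rho -> (w^T <= eigsp b (dual_rep rho))%MS ->
  rtype b (fun g => A *m rho g *m w).
Proof.
elim: b m rho p A => [|b0 b IH] m rho p A hr wE.
  move=> g h ug uh; rewrite (proj2 hr) // -!mulmxA; congr (_ *m (_ *m _)).
  apply: trmx_inj; rewrite trmx_mul -[h in rho h]invmxK.
  rewrite -[RHS]scale1r; apply/eigenspaceP; apply: submx_trans wE _.
  by rewrite /= (bigcapmx_inf (invmx h)) // unitmx_inv.
case: m rho hr wE => [|m] rho hr //=; rewrite sub_capmx => /andP[/rowwtP w1 w2]; split.
  move=> g x ug; rewrite (proj2 hr) ?aff_unit ?unitmx1 // -!mulmxA !scalemxAr; congr (_ *m (_ *m _)).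
  apply: trmx_inj; rewrite trmx_mul linearZ /= -w1 /dual_rep; congr (_ *m (rho _)^T).
  have := F2mx_addrr x; rewrite -[x in _ + x]mulmx1 => xx.
  have ux : aff x 1%:M \in unitmx by rewrite aff_unit unitmx1.
  by apply: (can_inj (mulKmx ux)); rewrite mulmxV // affM xx mulmx1 aff01.
move=> g ug; apply: (@rtype_eq _ _ _ _ (fun h => (A *m rho g) *m rho (aff 0 h) *m w)).
  by move=> h uh; rewrite (proj2 hr) ?aff_unit // !mulmxA.
apply: (IH _ (fun h => rho (aff 0 h))); first exact: affhom_unithom (unithom_affhom hr).
rewrite (@eigsp_eq _ _ _ (fun k => dual_rep rho (aff 0 k))) // => k.
by rewrite /dual_rep invmx_aff0.
Qed.
End Eigsp.

(** * Schur orthogonality *)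

Section Schur.
Variable G : groupType.

Lemma schur_iso n1 n2 (rho1 : G -> 'M[C]_n1) (rho2 : G -> 'M[C]_n2) (B : 'M[_]_(n1, n2)) :
  rep_irreducible rho1 -> rep_irreducible rho2 ->
  (forall g, rho1 g *m B = B *m rho2 g) -> B != 0 -> rep_iso rho1 rho2.
Proof.
move=> [n1_gt0 irr1] [n2_gt0 irr2] BE B0.
have kB : row_free B.
  rewrite -kermx_eq0; have [g|/eqP //|] := irr1 (kermx B).
    by apply/sub_kermxP; rewrite -mulmxA BE mulmxA mulmx_ker mul0mx.
  move=> fk; case/negP: B0; apply/eqP.
  have /sub_kermxP : (1%:M <= kermx B)%MS by rewrite submx_full.
  by rewrite mul1mx.
have fB : row_full B.
  have [g|B00|] := irr2 <<B>>%MS.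
  - rewrite (eqmxMr _ (genmxE B)) genmxE -BE; exact: submxMl.
  - by case/negP: B0; rewrite -submx0 -B00 genmxE.
  - by rewrite /row_full genmxE.
have e : n1 = n2 by rewrite -(eqP kB) (eqP fB).
case: n2 / e rho2 B BE kB {B0 fB irr2 n2_gt0} => rho2 B BE kB.
exists erefl, B; split; first by rewrite -row_free_unit.
by move=> g; rewrite castmx_id.
Qed.

Lemma schur_scalar n (rho : G -> 'M[C]_n) (B : 'M[_]_n) :
  rep_irreducible rho -> (forall g, rho g *m B = B *m rho g) -> exists a, B = a%:M.
Proof.
move=> [n_gt0 irr] BE; have [a] := eigenvalue_closed B n_gt0.
rewrite /eigenvalue /eigenspace => ka; exists a.
have [g|/eqP k0|fk] := irr (kermx (B - a%:M)).
- apply/sub_kermxP; rewrite -mulmxA mulmxBr BE scalar_mxC -mulmxBl mulmxA.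
  by rewrite mulmx_ker mul0mx.
- by rewrite k0 in ka.
- have /sub_kermxP : (1%:M <= kermx (B - a%:M))%MS by rewrite submx_full.
  by rewrite mul1mx => /eqP; rewrite subr_eq0 => /eqP.
Qed.

Section Average.
Variable S : seq G.
Hypotheses (S_uniq : uniq S) (S1 : 1%g \in S).
Hypothesis SM : forall x y, x \in S -> y \in S -> (x * y)%g \in S.

(** S meets every class modulo the kernel of rho, so sums over S replace averages over a finite
    quotient. *)
Definition finite_model n (rho : G -> 'M[C]_n) (h : G -> G) :=
  forall g, h g \in S /\ rho g = rho (h g).

Definition avg n1 n2 (rho1 : G -> 'M[C]_n1) (rho2 : G -> 'M[C]_n2) X :=
  \sum_(y <- S) rho1 y *m X *m rho2 y^-1%g.

Lemma perm_mul_closed x : x \in S -> perm_eq [seq (x * y)%g | y <- S] S.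
Proof.
move=> xS; have inj : injective (fun y => (x * y)%g) by exact: mulgI.
have u : uniq [seq (x * y)%g | y <- S] by rewrite map_inj_uniq.
apply: uniq_perm => //; apply: (uniq_min_size u _ _).2 => [z|]; last by rewrite size_map.
by case/mapP=> y yS ->; exact: SM.
Qed.

Lemma avg_intertwines n1 n2 (rho1 : G -> 'M[C]_n1) (rho2 : G -> 'M[C]_n2) X h :
  is_rep rho1 -> is_rep rho2 -> finite_model rho1 h -> finite_model rho2 h ->
  forall g, rho1 g *m avg rho1 rho2 X = avg rho1 rho2 X *m rho2 g.
Proof.
move=> [r1 r1M] [r2 r2M] m1 m2 g; have [hS ->] := m1 g; have [_ ->] := m2 g.
rewrite {1}/avg mulmx_sumr /avg -[in RHS](perm_big _ (perm_mul_closed hS)) big_map mulmx_suml.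
apply: eq_bigr => y _; rewrite r1M !mulmxA -[RHS]mulmxA -r2M.
by rewrite invgM -mulgA mulVg mulg1.
Qed.

Lemma avg_trace n (rho : G -> 'M[C]_n) X : is_rep rho ->
  \tr (avg rho rho X) = (size S)%:R * \tr X.
Proof.
case=> r1 rM; rewrite raddf_sum /= -sum1_size natr_sum mulr_suml.
apply: eq_bigr => y _; rewrite mxtrace_mulC mulmxA -rM mulVg r1 mul1mx.
by rewrite mul1r.
Qed.

(** Schur orthogonality: averaging [w a *m x] between [rho a] and [rho b] gives 0 for a != b, and
    for a = b a scalar whose trace is the size of S times [x *m w b]. The assumed relation then
    isolates [c b]. *)
Lemma matrix_coef_free (I : finType) (n : I -> nat) (rho : forall a, G -> 'M[C]_(n a))
    (v : forall a, 'rV[C]_(n a)) (w : forall a, 'cV[C]_(n a)) (c : I -> C) h :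
  (forall a, is_rep (rho a)) -> (forall a, rep_irreducible (rho a)) ->
  (forall a, finite_model (rho a) h) ->
  (forall a b, a != b -> ~ rep_iso (rho a) (rho b)) ->
  (forall a, v a != 0) -> (forall a, w a != 0) ->
  (forall y, y \in S -> \sum_a c a *: (v a *m rho a y *m w a) = 0) ->
  forall a, c a = 0.
Proof.
move=> hr hi hm hn v0 w0 sum0 b.
have [i wi] : exists i, w b i 0 != 0.
  apply/existsP; apply: contraNT (w0 b); rewrite negb_exists => /forallP H.
  by apply/eqP/matrixP => i j; rewrite ord1 mxE; apply/eqP; move: (H i); rewrite negbK.
have [j vj] : exists j, v b 0 j != 0.
  apply/existsP; apply: contraNT (v0 b); rewrite negb_exists => /forallP H.
  by apply/eqP/matrixP => k j; rewrite ord1 mxE; apply/eqP; move: (H j); rewrite negbK.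
(* Basis vectors chosen at nonzero entries of [w b] and [v b], so that [x *m w b] and [v b *m y] do
   not vanish. *)
pose x : 'rV[C]_(n b) := delta_mx 0 i; pose y : 'cV[C]_(n b) := delta_mx j 0.
have E : \sum_a c a *: (v a *m avg (rho a) (rho b) (w a *m x) *m y) = 0.
  rewrite (eq_bigr (fun a => \sum_(z <- S)
     (c a *: (v a *m rho a z *m w a)) *m (x *m rho b z^-1%g *m y))); last first.
    move=> a _; rewrite mulmx_sumr mulmx_suml scaler_sumr; apply: eq_bigr => z _.
    by rewrite -scalemxAl !mulmxA.
  rewrite exchange_big big_seq big1 // => z zS.
  by rewrite -mulmx_suml sum0 // mul0mx.
move: E; rewrite (bigD1 b) //= big1 ?addr0 => [|a ab]; last first.
  suff -> : avg (rho a) (rho b) (w a *m x) = 0 by rewrite mulmx0 mul0mx scaler0.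
  apply/eqP/negPn/negP => /(schur_iso (hi a) (hi b) (avg_intertwines _ _ _ _ _)) iso.
  by apply: hn ab (iso h _ _ _ _).
have [t tE] := schur_scalar (hi b) (avg_intertwines (w b *m x) (hr b) (hr b) (hm b) (hm b)).
have := avg_trace (w b *m x) (hr b); rewrite tE mxtrace_scalar mxtrace_mulC => tr.
rewrite mul_mx_scalar -scalemxAl scalerA => /matrixP/(_ 0 0).
rewrite -colE !mxE => /eqP; rewrite !mulf_eq0 (negPf vj) orbF.
case/orP => [/eqP //|/eqP t0]; move: tr; rewrite t0 mul0rn /x -rowE trace_mx11 mxE => /esym/eqP.
rewrite mulf_eq0 (negPf wi) orbF pnatr_eq0 size_eq0 => /eqP S0.
by move: S1; rewrite S0.
Qed.
End Average.
End Schur.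

(** The chain for each further factor is run inside the subspace found so far, which is stable
    because the factors commute. The dimension gains multiply, so the sum of the exponents is
    bounded by the logarithm of n. *)
Lemma multi_chain (K : numFieldType) (d : nat -> nat) n (r : forall i, 'M['F_2]_(d i) -> 'M[K]_n) s :
  (0 < n)%N -> (forall i, unithom (r i)) ->
  (forall i j g h, i != j -> g \in unitmx -> h \in unitmx -> r i g *m r j h = r j h *m r i g) ->
  exists (b : nat -> seq bool) (E : nat -> nat),
    (forall i, (i < s)%N -> (size (b i) <= d i)%N /\
       (size (b i) * (2 * d i) <= 4 * E i + size (b i) * size (b i) + 2 * size (b i))%N) /\
    exists W : 'M[_]_n, [/\ (0 < \rank W)%N, (2 ^ (\sum_(i < s) E i) * \rank W <= n)%N,
      forall i, (i < s)%N -> (W <= eigsp (b i) (r i))%MS &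
      forall i g, (s <= i)%N -> g \in unitmx -> stablemx W (r i g)].
Proof.
move=> n0 hr rC; elim: s => [|s [b [E [HbE [W [W0 WE Web Wst]]]]]].
  exists (fun=> [::]), (fun=> 0); split=> //; exists 1%:M; split=> //.
  - by rewrite mxrank1.
  - by rewrite big_ord0 mul1n mxrank1.
  - by move=> i g _ _; rewrite submx_full // row_full_unit unitmx1.
have [||b1 [E1 [[G1 G2] sb1 L1]]] := (chain_pair K (d s)).1 n (r s) W (hr s).
- by move=> g ug; exact: Wst.
- by rewrite -mxrank_eq0 -lt0n.
exists (fun i => if i == s then b1 else b i), (fun i => if i == s then E1 else E i).
split=> [i|].
  by rewrite ltnS leq_eqVlt; case: eqP => [-> //|_ /= /HbE].
exists (W :&: eigsp b1 (r s))%MS; split=> //.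
- rewrite big_ord_recr /= eqxx (eq_bigr (fun i : 'I_s => E i)) => [|i _]; last by rewrite ltn_eqF.
  rewrite expnD -mulnA; apply: leq_trans WE; by rewrite leq_mul2l G2 orbT.
- move=> i; rewrite ltnS leq_eqVlt; case: eqP => [-> _|_ /= si]; first exact: capmxSr.
  by apply: submx_trans (capmxSl _ _) (Web _ si).
- move=> i g si ug; rewrite sub_capmx; apply/andP; split.
    by apply: submx_trans (submxMr _ (capmxSl _ _)) (Wst _ _ (ltnW si) ug).
  apply: submx_trans (submxMr _ (capmxSr _ _)) _.
  by apply: eigsp_stable => h uh; apply: rC => //; rewrite ltn_eqF.
Qed.

Lemma rtype_lin (K : comPzRingType) (V : lmodType K) b m (I : finType)
    (F : I -> 'M['F_2]_m -> V) (c : I -> K) :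
  (forall i, rtype b (F i)) -> rtype b (fun g => \sum_i c i *: F i g).
Proof.
elim: b m F => [|b0 b IH] [|m] F HF //=.
- by move=> g h ug uh; apply: eq_bigr => i _; rewrite (HF i).
- by move=> g h ug uh; apply: eq_bigr => i _; rewrite (HF i).
split=> [g x ug|g ug].
  rewrite scaler_sumr; apply: eq_bigr => i _.
  by rewrite (HF i).1 // !scalerA mulrC.
by apply: IH => i; exact: (HF i).2.
Qed.

Fixpoint bool_lists (N : nat) : seq (seq bool) :=
  if N is N'.+1 then [::] :: [seq x :: l | x <- [:: true; false], l <- bool_lists N']
  else [:: [::]].

Lemma size_bool_lists N : (size (bool_lists N) <= 2 ^ N.+1)%N.
Proof.
suff: (size (bool_lists N) < 2 ^ N.+1)%N by exact: ltnW.
elim: N => // N IH; rewrite /= !cats0 size_cat !size_map expnS; lia.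
Qed.

Lemma mem_bool_lists N l : (size l <= N)%N -> l \in bool_lists N.
Proof.
elim: N l => [|N IH] [|x l] //= lN; rewrite inE /= cats0 mem_cat.
by case: x; rewrite map_f ?IH ?orbT.
Qed.

Fixpoint type_lists (J : nat -> nat) (s : nat) : seq (seq (seq bool)) :=
  if s is s'.+1 then [seq rcons t b | t <- type_lists J s', b <- bool_lists (J s')]
  else [:: [::]].

Lemma size_type_lists J s : (size (type_lists J s) <= \prod_(i < s) 2 ^ (J i).+1)%N.
Proof.
elim: s => [|s IH]; first by rewrite big_ord0.
by rewrite /= size_allpairs big_ord_recr leq_mul // size_bool_lists.
Qed.

Lemma mem_type_lists J s b : (forall i, (i < s)%N -> (size (b i) <= J i)%N) ->
  mkseq b s \in type_lists J s.
Proof.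
elim: s => // s IH H; rewrite mkseqS /=; apply/allpairsP.
exists (mkseq b s, b s); split=> //=; last by apply: mem_bool_lists; exact: H.
by apply: IH => i si; apply: H; exact: ltnW.
Qed.

Lemma bool_lists_size N l : l \in bool_lists N -> (size l <= N)%N.
Proof.
elim: N l => [|N IH] l; first by rewrite inE => /eqP ->.
rewrite inE => /orP[/eqP -> //|/allpairsP[[x k] [_ /= /IH kN ->]]].
by rewrite /= ltnS.
Qed.

Lemma type_lists_size J s t : t \in type_lists J s ->
  size t = s /\ forall i, (size (nth [::] t i) <= J i)%N.
Proof.
elim: s t => [|s IH] t; first by rewrite inE => /eqP ->; split=> // i; rewrite nth_nil.
case/allpairsP => -[u b] [/= /IH[us H] /bool_lists_size bJ ->].
rewrite size_rcons us; split=> // i; rewrite nth_rcons us.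
by case: ltngtP => [_|//|->//]; exact: H.
Qed.

(** * Counting representations of commuting families of GL_d(F_2) *)

Section Count.
Variables (G : groupType) (d : nat -> nat) (iot : forall i, 'M['F_2]_(d i) -> G).
Hypothesis d_gt0 : forall i, (0 < d i)%N.
Hypothesis iot1 : forall i, iot (1%:M : 'M[_]_(d i)) = 1%g.
Hypothesis iotM : forall i (g h : 'M[_]_(d i)), g \in unitmx -> h \in unitmx ->
  iot (g *m h) = (iot g * iot h)%g.
Hypothesis iotC : forall i j (g : 'M[_]_(d i)) (h : 'M[_]_(d j)), i != j ->
  g \in unitmx -> h \in unitmx -> commute (iot g) (iot h).

(** The image in G of the product of the first k groups GL_(d i)(F_2). *)
Fixpoint fin_part (k : nat) : seq G :=
  if k is k'.+1 then
    undup [seq (x * iot g)%g | x <- fin_part k', g <- enum (@unitmx 'F_2 (d k'))]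
  else [:: 1%g].

Lemma fin_partS k y : reflect
  (exists x (g : 'M[_]_(d k)), [/\ x \in fin_part k, g \in unitmx & y = (x * iot g)%g])
  (y \in fin_part k.+1).
Proof.
rewrite mem_undup; apply: (iffP allpairsP) => [[[x g] [/= xk]]|[x [g [xk ug ->]]]].
  by rewrite mem_enum => ug ->; exists x, g.
by exists (x, g); rewrite mem_enum.
Qed.

Lemma fin_part_uniq k : uniq (fin_part k).
Proof. by case: k => //= k; exact: undup_uniq. Qed.

Lemma fin_part1 k : 1%g \in fin_part k.
Proof.
elim: k => [|k IH]; first by rewrite inE.
by apply/fin_partS; exists 1%g, 1%:M; rewrite iot1 mulg1 unitmx1.
Qed.

Lemma fin_part_comm k i x (g : 'M[_]_(d i)) : x \in fin_part k -> (k <= i)%N -> g \in unitmx ->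
  commute x (iot g).
Proof.
elim: k x => [|k IH] x; first by rewrite inE => /eqP -> _ _; exact/commute_sym/commute1.
case/fin_partS => y [h [yk uh ->]] ki ug.
rewrite /commute -mulgA (iotC _ uh ug) ?mulgA; last by rewrite ltn_eqF.
by rewrite (IH _ yk (ltnW ki) ug).
Qed.

Lemma fin_partM k x y : x \in fin_part k -> y \in fin_part k -> (x * y)%g \in fin_part k.
Proof.
elim: k x y => [|k IH] x y; first by rewrite !inE => /eqP -> /eqP ->; rewrite mulg1.
case/fin_partS => a [g [ak ug ->]] /fin_partS[b [h [bk uh ->]]].
apply/fin_partS; exists (a * b)%g, (g *m h); rewrite IH // unitmx_mul ug uh; split=> //.
by rewrite iotM // !mulgA; congr (_ * _)%g; rewrite -!mulgA (fin_part_comm bk _ ug).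
Qed.

Fixpoint tail_points (b : nat -> seq bool) (k m : nat) : seq G :=
  if m is m'.+1 then
    [seq (iot g * z)%g | g <- test_points (size (b k)) (d k), z <- tail_points b k.+1 m']
  else [:: 1%g].

Lemma tail_points_comm b k m i z (g : 'M[_]_(d i)) : z \in tail_points b k m -> (i < k)%N ->
  g \in unitmx -> commute z (iot g).
Proof.
elim: m k z => [|m IH] k z; first by rewrite inE => /eqP -> _ _; exact/commute_sym/commute1.
case/allpairsP => -[h y] [/= /test_points_unit uh yk ->] ik ug.
rewrite /commute -mulgA (IH _ _ yk (ltnW _)) // mulgA (iotC _ uh ug) ?mulgA //.
by rewrite gtn_eqF.
Qed.

Lemma size_tail_points b k m (J : nat -> nat) :
  (forall i, (i < m)%N -> (size (b (k + i)) <= J (k + i))%N) ->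
  (size (tail_points b k m) <= \prod_(i < m) d (k + i) ^ J (k + i))%N.
Proof.
elim: m k => [|m IH] k H /=; first by rewrite big_ord0.
rewrite size_allpairs big_ord_recl /= addn0; apply: leq_mul.
  apply: leq_trans (size_test_points _ (leqnn _) (d_gt0 k)) _.
  by rewrite leq_pexp2l // -[k in b k]addn0 -[k in J k]addn0 H.
under eq_bigr => i _ do rewrite /bump /= add1n addnS -addSn.
by apply: IH => i im; rewrite addSn -addnS H.
Qed.

Definition rep_at n (rho : G -> 'M[C]_n) i (g : 'M[_]_(d i)) := rho (iot g).

Lemma rep_at_unithom n (rho : G -> 'M[C]_n) i : is_rep rho -> unithom (@rep_at n rho i).
Proof.
by case=> r1 rM; split=> [|g h ug uh]; rewrite /rep_at ?iot1 // iotM // rM.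
Qed.

Definition has_type s n (rho : G -> 'M[C]_n) (b b' : nat -> seq bool) (v : 'rV_n) (w : 'cV_n) :=
  forall i, (i < s)%N ->
    (v <= eigsp (b i) (@rep_at n rho i))%MS /\ (w^T <= eigsp (b' i) (dual_rep (@rep_at n rho i)))%MS.

Lemma coef_vanish (I : finType) (n : I -> nat) (rho : forall a, G -> 'M[C]_(n a))
    v w (c : I -> C) s b b' :
  (forall a, is_rep (rho a)) -> (forall a, has_type s (rho a) b b' (v a) (w a)) ->
  (forall z, z \in tail_points b' 0 s -> \sum_a c a *: (v a *m rho a z *m w a) = 0) ->
  forall y, y \in fin_part s -> \sum_a c a *: (v a *m rho a y *m w a) = 0.
Proof.
move=> hr ht F0.
(* The factors are handled one at a time: y is arbitrary in the first k factors and z a product of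
   test points in the other m. The case k = 0 is the hypothesis, and k = s is the claim. *)
suff H k m : (k + m = s)%N -> forall y z, y \in fin_part k -> z \in tail_points b' k m ->
    \sum_a c a *: (v a *m rho a (y * z)%g *m w a) = 0.
  by move=> y ys; have := H s 0 (addn0 s) y 1%g ys; rewrite mulg1; apply; rewrite inE.
elim: k m => [|k IH] m kms y z.
  by rewrite inE => /eqP -> zt; rewrite mul1g; apply: F0; rewrite -kms.
case/fin_partS => x [g [xk ug ->]] zt.
have ks : (k < s)%N by rewrite -kms addSn ltnS leq_addr.
pose Phi (h : 'M[_]_(d k)) := \sum_a c a *: ((v a *m rho a (x * z)%g) *m rep_at (rho a) h *m w a).
have PhiE h : h \in unitmx ->
    \sum_a c a *: (v a *m rho a (x * iot h * z)%g *m w a) = Phi h.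
  move=> uh; apply: eq_bigr => a _; rewrite -mulgA -(tail_points_comm zt (ltnSn k) uh).
  by rewrite mulgA (hr a).2 mulmxA.
rewrite PhiE //; apply: (rtype_determined (b := b' k)) ug.
- apply: rtype_lin => a; apply: eigsp_dual_rtype; first exact: rep_at_unithom.
  exact: (ht a k ks).2.
- move=> u h Hu uh; have uu := unitriangular_unit Hu.
  suff -> : Phi (u *m h) = psi C (b k) u *: Phi h.
    by move/eqP; rewrite scaler_eq0 (negPf (psi_neq0 _ _ _)) => /eqP.
  rewrite /Phi scaler_sumr; apply: eq_bigr => a _; rewrite scalerA mulrC -scalerA; congr (_ *: _).
  rewrite /rep_at iotM // (hr a).2 !mulmxA -(mulmxA (v a)) -(hr a).2 -mulgA.
  rewrite (tail_points_comm zt (ltnSn k) uu) mulgA (fin_part_comm xk (leqnn _) uu) -mulgA.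
  have [vE _] := ht a k ks.
  by rewrite (hr a).2 mulmxA (eigsp_left (rep_at_unithom k (hr a)) vE Hu) -!scalemxAl.
- move=> h hp; rewrite -PhiE ?(test_points_unit hp) // -mulgA; apply: (IH m.+1) => //.
    by rewrite addnS -addSn.
  by apply/allpairsP; exists (h, z).
Qed.

(** Coefficients of a common type are determined by their values at the test points, and those of
    pairwise non-isomorphic irreducibles are independent. With more representations than test points
    the matrix M of values would have a nonzero left kernel, a contradiction. *)
Lemma type_family_bound t (n : 'I_t -> nat) (rho : forall a, G -> 'M[C]_(n a)) v w s b b' h :
  (forall a, is_rep (rho a)) -> (forall a, rep_irreducible (rho a)) ->
  (forall a, finite_model (fin_part s) (rho a) h) ->
  (forall a a', a != a' -> ~ rep_iso (rho a) (rho a')) ->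
  (forall a, has_type s (rho a) b b' (v a) (w a)) ->
  (forall a, v a != 0) -> (forall a, w a != 0) ->
  (t <= size (tail_points b' 0 s))%N.
Proof.
move=> hr hi hm hn ht v0 w0; rewrite leqNgt; apply/negP => lt_t.
set pts := tail_points b' 0 s in lt_t.
pose M := \matrix_(a < t, j < size pts) (v a *m rho a (nth 1%g pts j) *m w a) 0 0.
have : kermx M != 0.
  rewrite -mxrank_eq0 mxrank_ker subn_eq0 -ltnNge.
  exact: leq_ltn_trans (rank_leq_col _) lt_t.
case/rowV0Pn => c /sub_kermxP cM /negP; apply; apply/eqP/rowP => a; rewrite mxE.
apply: (matrix_coef_free (c := fun a => c 0 a) (fin_part_uniq s) (fin_part1 s) (@fin_partM s)
  hr hi hm hn v0 w0).
apply: coef_vanish => // z zp; apply/matrixP => i j; rewrite !ord1 [RHS]mxE summxE.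
have zi : (index z pts < size pts)%N by rewrite index_mem.
move/matrixP/(_ 0 (Ordinal zi)): cM; rewrite !mxE => cM; rewrite -[RHS]cM.
by apply: eq_bigr => a' _; rewrite mxE [in RHS]mxE /= nth_index.
Qed.

(** In dimension below 2^(L+1) the exponents of the chains sum to at most L; [J i] caps the length
    of a type at factor i under this constraint. *)
Variables (L : nat) (J : nat -> nat).
Hypothesis HJ : forall i j E, (E <= L)%N -> (j <= d i)%N ->
  (j * (2 * d i) <= 4 * E + j * j + 2 * j)%N -> (j <= J i)%N.

Lemma rep_at_comm n (rho : G -> 'M[C]_n) i j (g : 'M[_]_(d i)) (h : 'M[_]_(d j)) : is_rep rho ->
  i != j -> g \in unitmx -> h \in unitmx -> rep_at rho g *m rep_at rho h = rep_at rho h *m rep_at rho g.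
Proof. by move=> [r1 rM] ij ug uh; rewrite /rep_at -!rM iotC. Qed.

Lemma family_has_type s n (r : forall i, 'M['F_2]_(d i) -> 'M[C]_n) :
  (0 < n < 2 ^ L.+1)%N -> (forall i, unithom (r i)) ->
  (forall i j (g : 'M[_]_(d i)) (h : 'M[_]_(d j)), i != j -> g \in unitmx -> h \in unitmx ->
     r i g *m r j h = r j h *m r i g) ->
  exists t (v : 'rV_n), [/\ t \in type_lists J s, v != 0 &
    forall i, (i < s)%N -> (v <= eigsp (nth [::] t i) (r i))%MS].
Proof.
case/andP => n0 nL hr rC.
have [b [E [HbE [W [W0 WE Web _]]]]] := multi_chain s n0 hr rC.
have sumE : (\sum_(i < s) E i <= L)%N.
  rewrite -ltnS -(ltn_exp2l _ _ (isT : (1 < 2)%N)); apply: leq_ltn_trans nL.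
  by apply: leq_trans WE; rewrite leq_pmulr.
have [v vW v0] : exists2 v : 'rV_n, (v <= W)%MS & v != 0.
  by apply/rowV0Pn; rewrite -mxrank_eq0 -lt0n.
exists (mkseq b s), v; split=> // [|i si]; last first.
  by rewrite nth_mkseq //; exact: submx_trans vW (Web _ si).
apply: mem_type_lists => i si; have [bd bE] := HbE i si.
apply: HJ bE => //; apply: leq_trans sumE.
by rewrite (bigD1 (Ordinal si)) //= leq_addr.
Qed.

Lemma rep_has_type s n (rho : G -> 'M[C]_n) : is_rep rho -> (0 < n < 2 ^ L.+1)%N ->
  exists t t' v w, [/\ t \in type_lists J s, t' \in type_lists J s, v != 0, w != 0 &
    has_type s rho (nth [::] t) (nth [::] t') v w].
Proof.
move=> hr nL; have [|t [v [tJ v0 Hv]]] := family_has_type s nL (fun i => rep_at_unithom i hr).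
  by move=> i j g h; exact: rep_at_comm.
have [||t' [w [tJ' w0 Hw]]] := family_has_type s nL (r := fun i => dual_rep (@rep_at n rho i)).
- by move=> i; apply: dual_unithom; exact: rep_at_unithom.
- move=> i j g h ij ug uh; rewrite /dual_rep -!trmx_mul rep_at_comm ?unitmx_inv //.
  by rewrite eq_sym.
exists t, t', v, w^T; split=> //; first by rewrite trmx_eq0.
by move=> i si; rewrite trmxK; split; [exact: Hv|exact: Hw].
Qed.

(** The squared product bounds the pairs formed by a type and a dual type, and the last product
    bounds each class of representations sharing such a pair, by [type_family_bound]. *)
Lemma irr_family_bound N (n : 'I_N -> nat) (rho : forall a, G -> 'M[C]_(n a)) s h :
  (forall a, is_rep (rho a)) -> (forall a, rep_irreducible (rho a)) ->
  (forall a, finite_model (fin_part s) (rho a) h) ->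
  (forall a a', a != a' -> ~ rep_iso (rho a) (rho a')) ->
  (forall a, (n a < 2 ^ L.+1)%N) ->
  (N <= (\prod_(i < s) 2 ^ (J i).+1) ^ 2 * \prod_(i < s) d i ^ J i)%N.
Proof.
move=> hr hi hm hn nL.
have nL' a : (0 < n a < 2 ^ L.+1)%N by rewrite nL (proj1 (hi a)).
have ex a : exists q : seq (seq bool) * seq (seq bool) * ('rV[C]_(n a) * 'cV[C]_(n a)),
    [/\ q.1.1 \in type_lists J s, q.1.2 \in type_lists J s, q.2.1 != 0, q.2.2 != 0 &
      has_type s (rho a) (nth [::] q.1.1) (nth [::] q.1.2) q.2.1 q.2.2].
  have [t [t' [v [w H]]]] := rep_has_type s (hr a) (nL' a).
  by exists ((t, t'), (v, w)).
pose f a := (projT1 (cid (ex a))).1.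
pose v a : 'rV[C]_(n a) := (projT1 (cid (ex a))).2.1.
pose w a : 'cV[C]_(n a) := (projT1 (cid (ex a))).2.2.
have H a : [/\ (f a).1 \in type_lists J s, (f a).2 \in type_lists J s, v a != 0, w a != 0 &
    has_type s (rho a) (nth [::] (f a).1) (nth [::] (f a).2) (v a) (w a)].
  exact: (projT2 (cid (ex a))).
move: f v w H => f v w H {ex}.
pose T := [seq (x, y) | x <- type_lists J s, y <- type_lists J s].
have fT a : f a \in T by apply/allpairsP; exists (f a); have [? ? _ _ _] := H a; rewrite -surjective_pairing.
set K := (\prod_(i < s) d i ^ J i)%N.
have fiber p : p \in T -> (#|[set a | f a == p]| <= K)%N.
  case/allpairsP => -[x y] [/= xT yT ->]; set A := [set a | _].
  have fA (a : 'I_#|A|) : f (enum_val a) = (x, y).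
    by have := enum_valP a; rewrite inE => /eqP.
  apply: leq_trans (@type_family_bound _ (fun a => n (enum_val a)) (fun a => rho (enum_val a))
    (fun a => v (enum_val a)) (fun a => w (enum_val a)) s (nth [::] x)
    (nth [::] y) h _ _ _ _ _ _ _) _ => //.
  - move=> a a' aa'; apply: hn; apply: contraNN aa' => /eqP/enum_val_inj ->; exact: eqxx.
  - by move=> a; have [_ _ _ _] := H (enum_val a); rewrite fA.
  - by move=> a; have [] := H (enum_val a).
  - by move=> a; have [] := H (enum_val a).
  apply: (size_tail_points (k := 0)) => i _.
  by rewrite add0n; exact: (type_lists_size yT).2.
have -> : N = (\sum_(a < N) 1)%N by rewrite sum1_card card_ord.
apply: leq_trans (_ : \sum_(a < N) \sum_(p <- T) (f a == p) <= _)%N.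
  apply: leq_sum => a _; rewrite (big_rem _ (fT a)) /= eqxx; exact: leq_addr.
rewrite exchange_big /=; apply: leq_trans (_ : \sum_(p <- T) K <= _)%N.
  rewrite big_seq [leqRHS]big_seq; apply: leq_sum => p pT.
  apply: leq_trans (fiber p pT); rewrite -sum1_card big_mkcond /= [leqRHS]big_mkcond /=.
  by apply: leq_sum => a _; rewrite inE; case: eqP.
rewrite big_const_seq count_predT iter_addn_0 mulnC; apply: leq_mul => //.
by rewrite size_allpairs -mulnn leq_mul ?size_type_lists.
Qed.
End Count.

(** * The group *)

Lemma dfunext (A : Type) (B : A -> Type) (f g : forall x, B x) : (forall x, f x = g x) -> f = g.
Proof. exact: functional_extensionality_dep. Qed.

(** * Block elementary matrices *)

Section BlockElementary.
Variable k : nat.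

(** Matrices of size 3k are read as 3 by 3 arrays of blocks, the pair (a, p) being indexed by
    [mxvec_index a p]; [(blk a)^T *m x *m blk b] places x in block (a, b). *)
Definition blk (a : 'I_3) : 'M['F_2]_(k, 3 * k) := \matrix_(p, q) (q == mxvec_index a p)%:R.

Lemma mxvec_index_inj (a b : 'I_3) (p q : 'I_k) :
  (mxvec_index a p == mxvec_index b q) = (a == b) && (p == q).
Proof.
apply/eqP/andP => [|[/eqP -> /eqP ->] //].
have [h hK _] := curry_mxvec_bij 3 k => e.
have := hK (a, p); have := hK (b, q); rewrite /= e => -> // /(_ isT)[-> ->].
by rewrite !eqxx.
Qed.

Lemma row_blk a p : row p (blk a) = delta_mx 0 (mxvec_index a p).
Proof. by apply/matrixP => i j; rewrite !mxE ord1 eqxx. Qed.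

Lemma blk_orth a b : blk a *m (blk b)^T = (a == b)%:R%:M.
Proof.
apply/matrixP => p q; rewrite !mxE (bigD1 (mxvec_index a p)) //= big1 => [|r /negPf rp].
  by rewrite !mxE eqxx mul1r addr0 mxvec_index_inj; case: (a == b); case: (p == q).
by rewrite !mxE rp mul0r.
Qed.

Lemma blk_orth0 a b : a != b -> blk a *m (blk b)^T = 0.
Proof. by move=> /negPf ab; rewrite blk_orth ab raddf0. Qed.

Lemma blk_delta a b p q :
  (blk a)^T *m delta_mx p q *m blk b = delta_mx (mxvec_index a p) (mxvec_index b q).
Proof.
rewrite -(mul_delta_mx (0 : 'I_1)) mulmxA -mulmxA -rowE row_blk.
rewrite -(mul_delta_mx (0 : 'I_1) (mxvec_index a p)); congr (_ *m _).
by apply: trmx_inj; rewrite trmx_mul trmxK !trmx_delta -rowE row_blk.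
Qed.

Definition elm (a b : 'I_3) (x : 'M['F_2]_k) : 'M['F_2]_(3 * k) :=
  1%:M + (blk a)^T *m x *m blk b.

Lemma elmD a b x y : a != b -> elm a b (x + y) = elm a b x *m elm a b y.
Proof.
move=> ab; rewrite /elm [RHS]mulmxDl mul1mx [in RHS]mulmxDr mulmx1.
have -> : (blk a)^T *m x *m blk b *m ((blk a)^T *m y *m blk b) = 0.
  by rewrite -!mulmxA (mulmxA (blk b)) blk_orth0 1?eq_sym // !mul0mx !mulmx0.
by rewrite addr0 mulmxDr mulmxDl -addrA; congr (_ + _); rewrite addrC.
Qed.

Lemma elm0 a b : elm a b 0 = 1%:M.
Proof. by rewrite /elm mulmx0 mul0mx addr0. Qed.
End BlockElementary.

(* 1 + A and 1 + B are involutions over F_2, so the left side is their commutator. *)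
Lemma F2_commutator n (A B : 'M['F_2]_n) : A *m A = 0 -> B *m B = 0 -> B *m A = 0 ->
  (1%:M + A) *m (1%:M + B) *m ((1%:M + A) *m (1%:M + B)) = 1%:M + A *m B.
Proof.
move=> AA BB BA.
have -> : (1%:M + A) *m (1%:M + B) = 1%:M + (A + B + A *m B).
  by rewrite mulmxDl mul1mx mulmxDr mulmx1 !addrA; congr (_ + _); exact: addrAC.
have ABA : A *m B *m A = 0 by rewrite -mulmxA BA mulmx0.
have ABB : A *m B *m B = 0 by rewrite -mulmxA BB mulmx0.
set X := A + B + _; have XX : X *m X = A *m B.
  rewrite /X !mulmxDl !mulmxDr !mulmxA AA BB BA ABA ABB !mul0mx.
  by rewrite !(add0r, addr0).
rewrite mulmxDl mul1mx mulmxDr mulmx1 XX addrA -(addrA 1%:M) F2mx_addrr addr0 //.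
Qed.

Lemma elm_commutator k (a b c : 'I_3) (x y : 'M['F_2]_k) : a != b -> a != c -> b != c ->
  elm a c x *m elm c b y *m (elm a c x *m elm c b y) = elm a b (x *m y).
Proof.
move=> ab ac bc; rewrite /elm F2_commutator.
- by congr (_ + _); rewrite -!mulmxA (mulmxA (blk k c)) blk_orth eqxx mul1mx.
- by rewrite -!mulmxA (mulmxA (blk k c)) blk_orth0 1?eq_sym // !mul0mx !mulmx0.
- by rewrite -!mulmxA (mulmxA (blk k b)) blk_orth0 // !mul0mx !mulmx0.
- by rewrite -!mulmxA (mulmxA (blk k b)) blk_orth0 1?eq_sym // !mul0mx !mulmx0.
Qed.

(** * Sequences of matrices, their ring R and its elementary group *)

Definition deg (i : nat) : nat := 3 * 2 ^ i.

Definition mseq (D : nat -> nat) := forall i, 'M['F_2]_(D i).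

Definition seqM D (x y : mseq D) : mseq D := fun i => x i *m y i.
Definition seqD D (x y : mseq D) : mseq D := fun i => x i + y i.
Definition seq1 D : mseq D := fun=> 1%:M.
Definition seq0 D : mseq D := fun=> 0.
Arguments seq1 {D}.
Arguments seq0 {D}.

(* Locked, so that comparing distinct elementary elements never unfolds them. *)
HB.lock Definition el (a b : 'I_3) (x : mseq (expn 2)) : mseq deg := fun i => elm a b (x i).

Lemma elE a b x i : el a b x i = elm a b (x i).
Proof. by rewrite el.unlock. Qed.

Lemma rot_subproof i (p : 'I_(2 ^ i)) m : ((p + m) %% 2 ^ i < 2 ^ i)%N.
Proof. by rewrite ltn_mod expn_gt0. Qed.

Definition rot_ord i m (p : 'I_(2 ^ i)) : 'I_(2 ^ i) := Ordinal (rot_subproof p m).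

Definition cshift (m : nat) : mseq (expn 2) := fun i => \matrix_(p, q) (q == rot_ord m p)%:R.
Definition cunshift (m : nat) : mseq (expn 2) := fun i => (cshift m i)^T.
Definition corner : mseq (expn 2) :=
  fun i => \matrix_(p, q) ((p == 0 :> nat) && (q == 0 :> nat))%:R.
Definition diag_seq (phi : nat -> nat -> bool) : mseq (expn 2) :=
  fun i => \matrix_(p, q) ((p == q) && phi i p)%:R.
(* The period-doubling word, cut to period 2^i: the parity of the 2-adic
   valuation of p, or of i when 2^i divides p. *)
Definition doubling (i p : nat) : bool := odd (logn 2 (gcdn (2 ^ i) p)).

Definition ring_gen (j : 'I_5) : mseq (expn 2) :=
  nth seq1 [:: seq1; cshift 1; cunshift 1; corner; diag_seq doubling] j.

(** The monoid generated by finitely many elements; as these are involutions, it is a group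
    ([inG_inv]). *)
Inductive inG : mseq deg -> Prop :=
| inG1 : inG seq1
| inG_gen a b j : a != b -> inG (el a b (ring_gen j))
| inGM f g : inG f -> inG g -> inG (seqM f g).

Lemma el_M a b x y : a != b -> seqM (el a b x) (el a b y) = el a b (seqD x y).
Proof. by move=> ab; apply: dfunext => i; rewrite /seqM /seqD !elE elmD. Qed.

Lemma el_0 a b : el a b seq0 = seq1.
Proof. by apply: dfunext => i; rewrite elE elm0. Qed.

Lemma seqD_self D (x : mseq D) : seqD x x = seq0.
Proof. by apply: dfunext => i; exact: F2mx_addrr. Qed.

Lemma el_sq a b x : a != b -> seqM (el a b x) (el a b x) = seq1.
Proof. by move=> ab; rewrite el_M // seqD_self el_0. Qed.

Lemma el_commutator a b c x y : a != b -> a != c -> b != c ->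
  seqM (seqM (el a c x) (el c b y)) (seqM (el a c x) (el c b y)) = el a b (seqM x y).
Proof. by move=> ab ac bc; apply: dfunext => i; rewrite /seqM !elE elm_commutator. Qed.

Lemma seqMA D (x y z : mseq D) : seqM x (seqM y z) = seqM (seqM x y) z.
Proof. by apply: dfunext => i; exact: mulmxA. Qed.
Lemma seq1M D (x : mseq D) : seqM seq1 x = x.
Proof. by apply: dfunext => i; exact: mul1mx. Qed.
Lemma seqM1 D (x : mseq D) : seqM x seq1 = x.
Proof. by apply: dfunext => i; exact: mulmx1. Qed.

Definition seqV D (x : mseq D) : mseq D := fun i => invmx (x i).

Lemma inG_inv f : inG f -> exists2 g, inG g & seqM f g = seq1 /\ seqM g f = seq1.
Proof.
elim=> [|a b j ab|x y _ [x' Gx' [xx' x'x]] _ [y' Gy' [yy' y'y]]].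
- by exists seq1; [exact: inG1|rewrite seqM1].
- by exists (el a b (ring_gen j)); [exact: inG_gen|rewrite el_sq].
- exists (seqM y' x'); first exact: inGM.
  split; first by rewrite seqMA -(seqMA x) yy' seqM1.
  by rewrite seqMA -(seqMA y') x'x seqM1.
Qed.

Lemma inG_unit f i : inG f -> f i \in unitmx.
Proof.
case/inG_inv => g _ [/(congr1 (fun h : mseq deg => h i)) fg _].
by case: (mulmx1_unit fg).
Qed.

Lemma seqMV D (f : mseq D) : (forall i, f i \in unitmx) -> seqM f (seqV f) = seq1.
Proof. by move=> uf; apply: dfunext => i; exact: mulmxV. Qed.

Lemma inGV f : inG f -> inG (seqV f).
Proof.
move=> Gf; have [g Gg [fg gf]] := inG_inv Gf.
rewrite (_ : seqV f = g) // -[LHS]seq1M -gf -seqMA seqMV ?seqM1 // => i.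
exact: inG_unit.
Qed.

Definition inR (x : mseq (expn 2)) := forall a b, a != b -> inG (el a b x).

Lemma inR_gen j : inR (ring_gen j). Proof. by move=> a b ab; exact: inG_gen. Qed.
Lemma inR0 : inR seq0. Proof. by move=> a b ab; rewrite el_0; exact: inG1. Qed.
Lemma inR1 : inR seq1. Proof. exact: (inR_gen ord0). Qed.
Lemma inRD x y : inR x -> inR y -> inR (seqD x y).
Proof. by move=> Rx Ry a b ab; rewrite -el_M //; apply: inGM; [exact: Rx|exact: Ry]. Qed.

Lemma third (a b : 'I_3) : exists2 c : 'I_3, a != c & b != c.
Proof.
case: a => -[|[|[|//]]] ha; case: b => -[|[|[|//]]] hb.
all: first [by exists (inord 0); rewrite -val_eqE /= inordK
  | by exists (inord 1); rewrite -val_eqE /= inordK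
  | by exists (inord 2); rewrite -val_eqE /= inordK].
Qed.

(** The product is the commutator of two elementary elements through a third index, which degree 3
    provides. Hence finitely many ring generators yield the elementary elements of a whole ring. *)
Lemma inRM x y : inR x -> inR y -> inR (seqM x y).
Proof.
move=> Rx Ry a b ab; have [c ac bc] := third a b.
rewrite -(el_commutator _ _ ab ac bc); do 2!apply: inGM.
all: by [exact: Rx|apply: Ry; rewrite eq_sym].
Qed.

Lemma shiftD m n : seqM (cshift m) (cshift n) = cshift (m + n).
Proof.
apply: dfunext => i; apply/matrixP => p q; rewrite !mxE (bigD1 (rot_ord m p)) //= big1.
  rewrite !mxE eqxx mul1r addr0; congr (_ == _)%:R; apply: val_inj => /=.
  by rewrite modnDml addnA.
by move=> r /negPf rp; rewrite !mxE rp mul0r.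
Qed.

Lemma shift0 : cshift 0 = seq1.
Proof.
apply: dfunext => i; apply/matrixP => p q; rewrite !mxE eq_sym; congr (_ == _)%:R.
by apply: val_inj; rewrite /= addn0 modn_small.
Qed.

Lemma inR_shift m : inR (cshift m).
Proof.
elim: m => [|m IH]; first by rewrite shift0; exact: inR1.
by rewrite -addn1 -shiftD; apply: inRM => //; exact: (inR_gen (Ordinal (isT : (1 < 5)%N))).
Qed.

Lemma unshiftD m n : seqM (cunshift n) (cunshift m) = cunshift (m + n).
Proof. by apply: dfunext => i; rewrite /seqM /cunshift -trmx_mul -[_ *m _]/(seqM _ _ i) shiftD. Qed.

Lemma inR_unshift m : inR (cunshift m).
Proof.
elim: m => [|m IH].
  rewrite (_ : cunshift 0 = seq1); first exact: inR1.
  by apply: dfunext => i; rewrite /cunshift shift0 trmx1.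
by rewrite -addn1 -unshiftD; apply: inRM => //; exact: (inR_gen (Ordinal (isT : (2 < 5)%N))).
Qed.

Lemma inR_corner : inR corner.
Proof. exact: (inR_gen (Ordinal (isT : (3 < 5)%N))). Qed.

Lemma inR_doubling : inR (diag_seq doubling).
Proof. exact: (inR_gen (Ordinal (isT : (4 < 5)%N))). Qed.

Lemma shift_mulE m i (A : 'M[_]_(2 ^ i)) p q : (cshift m i *m A) p q = A (rot_ord m p) q.
Proof.
rewrite mxE (bigD1 (rot_ord m p)) //= big1 => [|r /negPf rp]; rewrite mxE.
  by rewrite eqxx mul1r addr0.
by rewrite rp mul0r.
Qed.

Lemma mul_unshiftE m i (A : 'M[_]_(2 ^ i)) p q : (A *m cunshift m i) p q = A p (rot_ord m q).
Proof.
have -> : A *m cunshift m i = (cshift m i *m A^T)^T by rewrite trmx_mul trmxK.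
by rewrite [LHS]mxE shift_mulE mxE.
Qed.

Definition zero_ord i : 'I_(2 ^ i) := Ordinal (expn_gt0 2 i).

Lemma cornerE i : corner i = delta_mx (zero_ord i) (zero_ord i).
Proof. by apply/matrixP => p q; rewrite !mxE. Qed.

Definition single j (A : 'M['F_2]_(2 ^ j)) : mseq (expn 2) := eqtype.dfwith seq0 A.

Lemma delta_mul_delta (R : comPzRingType) m n p q (A : 'M[R]_(n, p)) (i : 'I_m) j k (l : 'I_q) :
  delta_mx i j *m A *m delta_mx k l = A j k *: delta_mx i l.
Proof.
rewrite -(mul_delta_mx (0 : 'I_1) i j) -(mul_delta_mx (0 : 'I_1) k l) -!mulmxA.
rewrite (mulmxA A) -colE (mulmxA (delta_mx 0 j)) -rowE.
have -> : row j (col k A) = (A j k)%:M.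
  by apply/matrixP => x y; rewrite !ord1 !mxE mulr1n.
by rewrite mul_scalar_mx -scalemxAr mul_delta_mx.
Qed.

Lemma corner_shift m i :
  corner i *m cshift m i *m corner i = (2 ^ i %| m)%:R *: corner i.
Proof.
rewrite cornerE delta_mul_delta mxE; congr (_%:R *: _).
by rewrite -val_eqE /= add0n eq_sym.
Qed.

(** The product of corner, shift by m and corner is the corner at the levels i with 2^i dividing m,
    and 0 elsewhere. The cases m = 2^(j+1) and m = 2^j differ at level j + 1 alone, and m = 1
    isolates level 0. *)
Lemma inR_single_corner j : inR (@single j (corner j)).
Proof.
pose u m := seqM (seqM corner (cshift m)) corner.
have Ru m : inR (u m) by apply: inRM inR_corner; apply: inRM inR_corner _; exact: inR_shift.
have uE m i : u m i = (2 ^ i %| m)%:R *: corner i by rewrite /u /seqM corner_shift.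
case: j => [|j].
  rewrite (_ : single _ = u 1) //; apply: dfunext => i; rewrite uE dvdn1 /single.
  case: (eqtype.dfwithP (T := fun i => 'M['F_2]_(2 ^ i)) seq0 (corner 0) i) => [|{}i i0].
    by have -> : (2 ^ 0 == 1)%N = true by []; rewrite scale1r.
  have -> : (2 ^ i == 1)%N = false by rewrite -[1%N]/(2 ^ 0)%N eqn_exp2l // eq_sym (negPf i0).
  by rewrite scale0r.
rewrite (_ : single _ = seqD (u (2 ^ j.+1)%N) (u (2 ^ j)%N)); first exact: inRD.
apply: dfunext => i; rewrite /seqD !uE !dvdn_Pexp2l // /single.
case: (eqtype.dfwithP (T := fun i => 'M['F_2]_(2 ^ i)) seq0 (corner j.+1) i) => [|{}i ij].
  by rewrite leqnn ltnn scale1r scale0r addr0.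
rewrite [in X in X *: _ + _]leq_eqVlt eq_sym (negPf ij) /= ltnS.
by rewrite F2mx_addrr.
Qed.

Lemma inR_single_delta j p q : inR (@single j (delta_mx p q)).
Proof.
rewrite (_ : single _ = seqM (seqM (cunshift p) (single (corner j))) (cshift q)).
  exact: (inRM (inRM (inR_unshift _) (inR_single_corner _)) (inR_shift _)).
apply: dfunext => i; rewrite /seqM /single.
case: (eqtype.dfwithP (T := fun i => 'M['F_2]_(2 ^ i)) seq0 (delta_mx p q) i) => [|{}i ij].
  have rotz (r : 'I_(2 ^ j)) : rot_ord r (zero_ord j) = r by apply: val_inj; exact: modn_small (ltn_ord r).
  have rowz (r : 'I_(2 ^ j)) : delta_mx (0 : 'I_1) (zero_ord j) *m cshift r j = delta_mx 0 r.
    by rewrite -rowE; apply/matrixP => x y; rewrite !mxE ord1 eqxx rotz eq_sym.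
  rewrite dfwith_in cornerE -(mul_delta_mx (0 : 'I_1) (zero_ord j)) mulmxA -mulmxA rowz.
  rewrite -[in LHS](mul_delta_mx (0 : 'I_1)); congr (_ *m _).
  by apply: trmx_inj; rewrite trmx_mul trmxK !trmx_delta rowz.
by rewrite dfwith_out // mulmx0 mul0mx.
Qed.

Definition iota_at j (g : 'M['F_2]_(deg j)) : mseq deg := eqtype.dfwith seq1 g.

Lemma iota_in j (g : 'M[_]_(deg j)) : iota_at g j = g.
Proof. exact: dfwith_in. Qed.

Lemma iota_out j (g : 'M[_]_(deg j)) i : j != i -> iota_at g i = 1%:M.
Proof. exact: dfwith_out. Qed.

Lemma iotaM j (g h : 'M[_]_(deg j)) : seqM (iota_at g) (iota_at h) = iota_at (g *m h).
Proof.
apply: dfunext => i; rewrite /seqM; have [<-|ji] := eqVneq j i; first by rewrite !iota_in.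
by rewrite !iota_out // mulmx1.
Qed.

Lemma iota1 j : iota_at (1%:M : 'M[_]_(deg j)) = seq1.
Proof.
by apply: dfunext => i; have [<-|ji] := eqVneq j i; rewrite ?iota_in ?iota_out.
Qed.

Lemma iotaC i j (g : 'M[_]_(deg i)) (h : 'M[_]_(deg j)) : i != j ->
  seqM (iota_at g) (iota_at h) = seqM (iota_at h) (iota_at g).
Proof.
move=> ij; apply: dfunext => k; rewrite /seqM.
have [ik|ik] := eqVneq i k; last by rewrite (iota_out g) // mul1mx mulmx1.
by rewrite (iota_out h) ?mul1mx ?mulmx1 // -ik eq_sym.
Qed.

Lemma el_single a b j (x : 'M[_]_(2 ^ j)) : el a b (single x) = iota_at (elm a b x).
Proof.
apply: dfunext => i; rewrite elE /single; have [<-|ji] := eqVneq j i.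
  by rewrite iota_in dfwith_in.
by rewrite iota_out // dfwith_out // elm0.
Qed.

Lemma inG_iota j (g : 'M[_]_(deg j)) : g \in unitmx -> inG (iota_at g).
Proof.
have base a b p q : a != b ->
    inG (iota_at (1%:M + delta_mx (mxvec_index a p) (mxvec_index b q) : 'M[_]_(deg j))).
  by move=> ab; rewrite -blk_delta -[1%:M + _]/(elm a b _) -el_single; exact: inR_single_delta.
move: g; apply: unitmx_ind_transvec => [|P Q|g h Hg Hh].
- by rewrite iota1; exact: inG1.
- case/mxvec_indexP: P => a p; case/mxvec_indexP: Q => b q; rewrite mxvec_index_inj => PQ.
  have [eab|ab] := eqVneq a b; last exact: base.
  (* A transvection inside a diagonal block is the commutator of two transvections passing through
     another block c. *)
  move: PQ; rewrite -eab eqxx /= => pq; have [c ac _] := third a a.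
  have npq : mxvec_index a p != mxvec_index a q by rewrite mxvec_index_inj eqxx.
  have npr : mxvec_index c p != mxvec_index a p by rewrite mxvec_index_inj eq_sym (negPf ac).
  have nqr : mxvec_index a q != mxvec_index c p by rewrite mxvec_index_inj (negPf ac).
  rewrite -(mul_delta_mx (mxvec_index c p)) -F2_commutator ?mul_delta_mx_cond ?(negPf npr) ?(negPf nqr) //.
    by rewrite -!iotaM; do 2!apply: inGM; apply: base => //; rewrite eq_sym.
  by rewrite eq_sym (negPf npq).
- by rewrite -iotaM; exact: inGM.
Qed.

Lemma inR_single j (A : 'M[_]_(2 ^ j)) : inR (single A).
Proof.
have s0 : single (0 : 'M[_]_(2 ^ j)) = seq0.
  by apply: dfunext => i; rewrite /single; case: eqtype.dfwithP.
have sD (B C : 'M[_]_(2 ^ j)) : single (B + C) = seqD (single B) (single C).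
  apply: dfunext => i; rewrite /seqD /single; have [<-|ji] := eqVneq j i.
    by rewrite !dfwith_in.
  by rewrite !dfwith_out // addr0.
rewrite [A]matrix_sum_delta.
elim/big_ind: _ => [|B C RB RC|p _]; first by rewrite s0; exact: inR0.
  by rewrite sD; exact: inRD.
elim/big_ind: _ => [|B C RB RC|q _]; first by rewrite s0; exact: inR0.
  by rewrite sD; exact: inRD.
case: (F2_cases (A p q)) => ->; first by rewrite scale0r s0; exact: inR0.
by rewrite scale1r; exact: inR_single_delta.
Qed.

Definition cutR s (x : mseq (expn 2)) : mseq (expn 2) := fun i => if (i < s)%N then 0 else x i.
Definition cutG s (f : mseq deg) : mseq deg := fun i => if (i < s)%N then 1%:M else f i.

Lemma inR_cut s x : inR x -> inR (cutR s x).
Proof.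
move=> Rx; elim: s => [|s IH]; first by rewrite (_ : cutR 0 x = x) //; exact: dfunext.
rewrite (_ : cutR s.+1 x = seqD (cutR s x) (single (x s))).
  by apply: inRD => //; exact: inR_single.
apply: dfunext => i; rewrite /cutR /seqD /single.
have [<-|si] := eqVneq s i; first by rewrite dfwith_in ltnSn ltnn F2mx_addrr.
by rewrite dfwith_out // addr0 ltnS leq_eqVlt eq_sym (negPf si).
Qed.

Lemma el_cut a b s x : el a b (cutR s x) = cutG s (el a b x).
Proof. by apply: dfunext => i; rewrite elE /cutR /cutG; case: ifP => _; rewrite ?elm0 ?elE. Qed.

Lemma cutGM s f g : cutG s (seqM f g) = seqM (cutG s f) (cutG s g).
Proof. by apply: dfunext => i; rewrite /cutG /seqM; case: ifP => // _; rewrite mulmx1. Qed.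

Lemma cutG1 s : cutG s seq1 = seq1.
Proof. by apply: dfunext => i; rewrite /cutG; case: ifP. Qed.

Lemma inG_cut s f : inG f -> inG (cutG s f).
Proof.
elim=> [|a b j ab|g h _ IHg _ IHh]; first by rewrite cutG1; exact: inG1.
  by rewrite -el_cut; apply: inR_cut => //; exact: inR_gen.
by rewrite cutGM; exact: inGM.
Qed.

(** * The group: finite generation, residual finiteness, infinitude *)

Record Gam := MkGam { gval :> mseq deg; gvalP : inG gval }.

Lemma gval_inj : injective gval.
Proof. by move=> [f Hf] [g Hg] /= E; case: g / E Hg => Hg; rewrite (Prop_irrelevance Hf Hg). Qed.

HB.instance Definition _ := gen_eqMixin Gam.
HB.instance Definition _ := gen_choiceMixin Gam.

Definition gone := MkGam inG1.
Definition gmul (f g : Gam) := MkGam (inGM (gvalP f) (gvalP g)).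
Definition ginv (f : Gam) := MkGam (inGV (gvalP f)).

Fact gmulA : associative gmul.
Proof. by move=> f g h; apply: gval_inj; exact: seqMA. Qed.
Fact gmul1 : left_id gone gmul.
Proof. by move=> f; apply: gval_inj; exact: seq1M. Qed.
Fact g1mul : right_id gone gmul.
Proof. by move=> f; apply: gval_inj; exact: seqM1. Qed.
Fact gmulV : right_inverse gone ginv gmul.
Proof. by move=> f; apply: gval_inj; apply: seqMV => i; apply: inG_unit (gvalP f). Qed.
Fact gVmul : left_inverse gone ginv gmul.
Proof.
move=> f; apply: gval_inj; apply: dfunext => i.
by apply: mulVmx; apply: inG_unit (gvalP f).
Qed.

HB.instance Definition _ := isGroup.Build Gam gmulA gmul1 g1mul gVmul gmulV.

Lemma gvalM (f g : Gam) : gval (f * g)%g = seqM f g. Proof. by []. Qed.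
Lemma gvalV (f : Gam) : gval f^-1%g = seqV f. Proof. by []. Qed.

(** Takes the default value 1 off the group, so that identities between sequences carry over without
    membership proofs in the terms. *)
Definition toG (f : mseq deg) : Gam := if pselect (inG f) is left H then MkGam H else 1%g.

Lemma toGK f : inG f -> gval (toG f) = f.
Proof. by rewrite /toG; case: pselect. Qed.

Lemma gvalK (f : Gam) : toG f = f.
Proof. by apply: gval_inj; rewrite toGK //; exact: gvalP. Qed.

Lemma toGM f g : inG f -> inG g -> toG (seqM f g) = (toG f * toG g)%g.
Proof. by move=> Hf Hg; apply: gval_inj; rewrite gvalM !toGK //; exact: inGM. Qed.

Lemma toG1 : toG seq1 = 1%g.
Proof. by apply: gval_inj; rewrite toGK //; exact: inG1. Qed.

Lemma Gam_fg : finitely_generated Gam.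
Proof.
exists [seq toG (el t.1.1 t.1.2 (ring_gen t.2)) | t <- enum {: 'I_3 * 'I_3 * 'I_5} & t.1.1 != t.1.2].
move=> x P P1 PM PV Ps; rewrite -[x]gvalK.
elim: (gvalP x) => [|a b j ab|f g Hf Pf Hg Pg]; first by rewrite toG1.
  apply: Ps; apply/mapP; exists ((a, b), j) => //.
  by rewrite mem_filter ab mem_enum.
by rewrite toGM //; exact: PM.
Qed.

(** A nontrivial element is nontrivial at some level i, where the group permutes the finite set of
    row vectors. *)
Lemma Gam_rf : residually_finite Gam.
Proof.
move=> x x1; have [i xi] : exists i, gval x i != 1%:M.
  apply/not_existsP => H; case/negP: x1; apply/eqP/gval_inj/dfunext => i.
  by apply/eqP/negPn/negP; exact: H.
have ux (y : Gam) : gval y i \in unitmx by exact: inG_unit (gvalP y).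
have inj (y : Gam) : injective (fun v : 'rV['F_2]_(deg i) => v *m gval y i).
  exact: can_inj (mulmxK (ux y)).
exists {perm 'rV['F_2]_(deg i)}, (fun y => perm (inj y)); split.
  by move=> a b; apply/permP => v; rewrite permM !permE /= mulmxA.
apply: contraNN xi => /eqP/permP H; apply/eqP/row_matrixP => r.
by rewrite rowE [in RHS]rowE mulmx1; have := H (delta_mx 0 r); rewrite permE perm1.
Qed.

Lemma Gam_infinite : infinite_group Gam.
Proof.
case=> s Hs.
have lt1 i : (1 < deg i)%N by rewrite /deg; have := expn_gt0 2 i; lia.
pose P i := Ordinal (ltnW (lt1 i)); pose Q i := Ordinal (lt1 i).
pose t i : 'M['F_2]_(deg i) := 1%:M + delta_mx (P i) (Q i).
have ut i : t i \in unitmx by have [] := mulmx1_unit (@F2_transvecK _ (P i) (Q i) isT).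
have e_inj : injective (fun i => toG (iota_at (t i))).
  move=> i j /(congr1 gval); rewrite !toGK; [|exact: inG_iota|exact: inG_iota] => E.
  apply/eqP/negPn/negP => ij; move/(congr1 (fun f : mseq deg => f i (P i) (Q i))): E.
  by rewrite iota_in iota_out 1?eq_sym // !mxE !eqxx.
have := @uniq_leq_size _ [seq toG (iota_at (t i)) | i <- iota 0 (size s).+1] s.
by rewrite map_inj_uniq // iota_uniq size_map size_iota ltnn => /(_ isT) H; case: notF; apply: H.
Qed.

(** * Finite-dimensional representations of the group *)

Lemma involution_diagonalizable (K : numFieldType) n (A : 'M[K]_n) :
  A *m A = 1%:M -> diagonalizable A.
Proof.
case: n A => [|n] A AA.
  exists 1%:M; first exact: unitmx1.
  by rewrite [A]flatmx0; apply/(@similar_diagLR _ 0 _ _ (unitmx1 _ _)); exists 0; rewrite !flatmx0.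
apply/diagonalizableP; exists [:: 1; -1].
  by rewrite /= andbT inE -subr_eq0 opprK -mulr2n pnatr_eq0.
apply: mxminpoly_min; rewrite !big_cons big_nil mulr1 rmorphM /= !rmorphB /= horner_mx_X !horner_mx_C.
rewrite -[1%:M]/(1 : 'M[_]_n.+1) raddfN opprK mulrDr mulr1 mulrBl mul1r.
by rewrite -[A * A]/(A *m A) AA addrA subrK subrr.
Qed.

(** Commuting involutions are simultaneously diagonal with entries 1 and -1, so among 2^n + 1 of
    them two coincide. *)
Lemma commuting_involutions_pigeonhole (K : numFieldType) n (h : nat -> 'M[K]_n) :
  (forall i, h i *m h i = 1%:M) -> (forall i j, h i *m h j = h j *m h i) ->
  exists i j, (i < j)%N /\ h i = h j.
Proof.
move=> hh hC; pose As := [seq h i | i <- iota 0 (2 ^ n).+1].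
have [|P uP /allP /= AsD] := (codiagonalizableP As).1.
  split=> [_ _ /mapP[i _ ->] /mapP[j _ ->]|_ /mapP[i _ ->]]; first exact: hC.
  exact: involution_diagonalizable.
have hD (i : 'I_(2 ^ n).+1) : exists D, P *m h i *m invmx P = diag_mx D /\ forall k, D 0 k = 1 \/ D 0 k = -1.
  have /AsD : h i \in As by apply: map_f; rewrite mem_iota add0n /=.
  case/(similar_diagLR uP) => D hE; exists D.
  have DE : P *m h i *m invmx P = diag_mx D.
    by rewrite hE conjumx ?unitmx_inv // invmxK !mulmxA mulmxV // mul1mx mulmxK.
  split=> // k; have : diag_mx D *m diag_mx D = 1%:M.
    by rewrite -DE !mulmxA mulmxKV // -(mulmxA P) hh mulmx1 mulmxV.
  move/matrixP/(_ k k); rewrite mul_diag_mx !mxE eqxx !mulr1n => /eqP.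
  by rewrite -expr2 sqrf_eq1 => /orP[]/eqP ->; [left|right].
pose D i := projT1 (cid (hD i)).
have DP (i : 'I_(2 ^ n).+1) : P *m h i *m invmx P = diag_mx (D i) /\ forall k, D i 0 k = 1 \/ D i 0 k = -1.
  exact: (projT2 (cid (hD i))).
pose code i : {ffun 'I_n -> bool} := [ffun k => D i 0 k == 1].
have [i [j [ij cij]]] : exists i j, i != j /\ code i = code j.
  apply/not_existsP => H; have inj : injective code.
    by move=> i j cij; apply/eqP/negPn/negP => ij; apply: (H i); exists j.
  by have := leq_card code inj; rewrite card_ffun card_bool !card_ord ltnn.
have hij : h i = h j.
  have Dij : D i = D j.
    apply/rowP => k; move/ffunP/(_ k): cij; rewrite !ffunE.
    have n11 : (-1 == 1 :> K) = false.
      by apply: negbTE; rewrite eq_sym -subr_eq0 opprK -mulr2n pnatr_eq0.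
    by case: ((DP i).2 k) => ->; case: ((DP j).2 k) => ->; rewrite ?eqxx ?n11.
  have E : P *m h i *m invmx P = P *m h j *m invmx P by rewrite (DP i).1 (DP j).1 Dij.
  by move/(congr1 (fun A => invmx P *m (A *m P))): E; rewrite !mulmxKV // !mulKmx.
case: (ltngtP i j) => [lt|gt|/val_inj e]; last by rewrite e eqxx in ij.
  by exists i, j.
by exists j, i.
Qed.

Lemma gcd_pow2 i p a : (a <= i)%N -> (2 ^ a %| p)%N -> (a < i -> ~~ (2 ^ a.+1 %| p))%N ->
  gcdn (2 ^ i) p = (2 ^ a)%N.
Proof.
move=> ai ap np; have /dvdn_pfactor[//|b bi E] := dvdn_gcdl (2 ^ i) p.
rewrite E; congr (2 ^ _)%N; apply/eqP; rewrite eqn_leq; apply/andP; split; last first.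
  by rewrite -(@dvdn_Pexp2l 2) // -E dvdn_gcd ap andbT dvdn_Pexp2l.
rewrite leqNgt; apply/negP => ab; case/negP: (np (leq_trans ab bi)).
by apply: dvdn_trans (dvdn_gcdr (2 ^ i) p); rewrite E dvdn_Pexp2l.
Qed.

Lemma doubling_mod i p : doubling i (p %% 2 ^ i) = doubling i p.
Proof. by rewrite /doubling gcdn_modr. Qed.

(* With a = v_2(N), positions p = 2^(a+1) mod 2^(a+2) have valuation a + 1
   whereas p + N has valuation a. *)
Lemma doubling_shift N i p : (0 < N)%N -> let a := logn 2 N in (a.+1 < i)%N ->
  p = 2 ^ a.+1 %[mod 2 ^ a.+2] -> doubling i p != doubling i (p + N).
Proof.
move=> N0 a ai pE; have [q Nq] := dvdnP (pfactor_dvdnn 2 N).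
have pa1 : (2 ^ a.+1 %| p)%N.
  by rewrite /dvdn -(modn_dvdm p (dvdn_exp2l 2 (leqnSn a.+1))) pE modn_dvdm ?dvdn_exp2l // modnn.
have pa2 : ~~ (2 ^ a.+2 %| p)%N.
  by rewrite /dvdn pE modn_small ?ltn_exp2l // -lt0n expn_gt0.
have aN : (2 ^ a %| N)%N by exact: pfactor_dvdnn.
have aN1 : ~~ (2 ^ a.+1 %| N)%N by rewrite pfactor_dvdn // ltnn.
rewrite /doubling (@gcd_pow2 i p a.+1) ?(ltnW ai) // (@gcd_pow2 i (p + N) a).
- by rewrite !pfactorK //=; case: (odd a).
- by apply: ltnW; exact: ltnW.
- by rewrite dvdn_addr // (dvdn_trans _ pa1) // dvdn_exp2l.
- by rewrite dvdn_addr.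
Qed.

Lemma shift_unshift m : seqM (cshift m) (cunshift m) = seq1.
Proof.
apply: dfunext => i; apply/matrixP => p q; rewrite /seqM mul_unshiftE !mxE.
have -> : (rot_ord m q == rot_ord m p) = (p == q) by rewrite -val_eqE /= eqn_modDr !modn_small // eq_sym.
by [].
Qed.

Lemma unshift_shift m : seqM (cunshift m) (cshift m) = seq1.
Proof.
apply: dfunext => i; apply: mulmx1C.
have := congr1 (fun f : mseq (expn 2) => f i) (shift_unshift m); exact.
Qed.

Lemma diag_conj m phi : (forall i p, phi i (p %% 2 ^ i)%N = phi i p) ->
  seqM (seqM (cshift m) (diag_seq phi)) (cunshift m) = diag_seq (fun i p => phi i (p + m)%N).
Proof.
move=> per; apply: dfunext => i; apply/matrixP => p q; rewrite /seqM mul_unshiftE shift_mulE !mxE.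
rewrite per; have -> : (rot_ord m p == rot_ord m q) = (p == q) by rewrite -val_eqE /= eqn_modDr !modn_small.
by [].
Qed.

(** * The congruence kernel of a finite-dimensional representation *)

Section CongruenceKernel.
Variables (n : nat) (rho : Gam -> 'M[C]_n).
Hypothesis hr : is_rep rho.

Let rh f := rho (toG f).

Lemma rhM f g : inG f -> inG g -> rh (seqM f g) = rh f *m rh g.
Proof. by move=> Hf Hg; rewrite /rh toGM // hr.2. Qed.

Lemma rh1 : rh seq1 = 1%:M.
Proof. by rewrite /rh toG1 hr.1. Qed.

Lemma rh_el_sq a b x : a != b -> inR x -> rh (el a b x) *m rh (el a b x) = 1%:M.
Proof. by move=> ab Rx; rewrite -rhM ?el_sq ?rh1 //; exact: Rx. Qed.

Lemma rh_el_mulr a b c x y : a != b -> a != c -> b != c -> inR x -> inR y ->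
  rh (el a c x) = 1%:M -> rh (el a b (seqM x y)) = 1%:M.
Proof.
move=> ab ac bc Rx Ry Hx; have cb : c != b by rewrite eq_sym.
have [Gx Gy] := (Rx a c ac, Ry c b cb).
rewrite -(el_commutator x y ab ac bc) !rhM //; try exact: inGM.
by rewrite Hx !mul1mx rh_el_sq.
Qed.

Lemma rh_el_mull a b c x y : a != b -> a != c -> b != c -> inR x -> inR y ->
  rh (el c b y) = 1%:M -> rh (el a b (seqM x y)) = 1%:M.
Proof.
move=> ab ac bc Rx Ry Hy; have cb : c != b by rewrite eq_sym.
have [Gx Gy] := (Rx a c ac, Ry c b cb).
rewrite -(el_commutator x y ab ac bc) !rhM //; try exact: inGM.
by rewrite Hy !mulmx1 rh_el_sq.
Qed.

(** A two-sided ideal of R by [kerRD], [kerRMr] and [kerRMl]; by [kerR_one_root] a single root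
    position already decides membership. *)
Definition kerR x := inR x /\ forall a b, a != b -> rh (el a b x) = 1%:M.

Lemma kerRD x y : kerR x -> kerR y -> kerR (seqD x y).
Proof.
move=> [Rx Kx] [Ry Ky]; split=> [|a b ab]; first exact: inRD.
by rewrite -el_M // rhM ?Kx ?Ky ?mulmx1 //; [exact: Rx|exact: Ry].
Qed.

Lemma kerRMr x y : kerR x -> inR y -> kerR (seqM x y).
Proof.
move=> [Rx Kx] Ry; split=> [|a b ab]; first exact: inRM.
by have [c ac bc] := third a b; apply: (rh_el_mulr (c := c)) => //; exact: Kx.
Qed.

Lemma kerRMl x y : inR x -> kerR y -> kerR (seqM x y).
Proof.
move=> Rx [Ry Ky]; split=> [|a b ab]; first exact: inRM.
by have [c ac bc] := third a b; apply: (rh_el_mull (c := c)) => //; apply: Ky; rewrite eq_sym.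
Qed.

(** Commutators with elementary elements of entry [seq1] transport triviality along a row or along a
    column; the six root positions are reached one after another. *)
Lemma kerR_one_root (a b : 'I_3) x : a != b -> inR x -> rh (el a b x) = 1%:M -> kerR x.
Proof.
move=> ab Rx Hx.
have R a' b' c' : a' != b' -> a' != c' -> b' != c' -> rh (el a' c' x) = 1%:M -> rh (el a' b' x) = 1%:M.
  by move=> ? ? ? H; rewrite -(seqM1 x); apply: (rh_el_mulr (c := c')) => //; exact: inR1.
have Lf a' b' c' : a' != b' -> a' != c' -> b' != c' -> rh (el c' b' x) = 1%:M -> rh (el a' b' x) = 1%:M.
  by move=> ? ? ? H; rewrite -(seq1M x); apply: (rh_el_mull (c := c')) => //; exact: inR1.
have [c ac bc] := third a b.
have [ca cb ba] : [/\ c != a, c != b & b != a] by split; rewrite eq_sym.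
have Hac := R a c b ac ab cb Hx; have Hcb := Lf c b a cb ca ba Hx.
have Hca := R c a b ca cb ab Hcb; have Hbc := Lf b c a bc ba ca Hac.
have Hba := R b a c ba bc ac Hbc.
have cases z : [|| z == a, z == b | z == c].
  move: ab ac bc (ltn_ord a) (ltn_ord b) (ltn_ord c) (ltn_ord z); rewrite -!val_eqE /=; lia.
split=> [|y z]; first exact: Rx.
case/or3P: (cases y) => /eqP ->; case/or3P: (cases z) => /eqP -> yz;
  [by rewrite eqxx in yz|exact: Hx|exact: Hac|exact: Hba|by rewrite eqxx in yz|exact: Hbc
  |exact: Hca|exact: Hcb|by rewrite eqxx in yz].
Qed.

Lemma kerR_cut x s : kerR x -> kerR (cutR s x).
Proof.
move=> Kx; rewrite (_ : cutR s x = seqM x (cutR s seq1)).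
  by apply: kerRMr => //; apply: inR_cut; exact: inR1.
by apply: dfunext => i; rewrite /seqM /cutR; case: ifP; rewrite ?mulmx0 ?mulmx1.
Qed.

(* Two powers T^i, T^j of the shift have equal images, so T^(j-i) - 1 is in the kernel. *)
Lemma kerR_shift : exists2 N, (0 < N)%N & kerR (seqD (cshift N) seq1).
Proof.
have o02 : (ord0 : 'I_3) != ord_max by [].
have Rs := inR_shift.
have [i|i j|i [j [ij E]]] :=
  @commuting_involutions_pigeonhole _ n (fun m => rh (el ord0 ord_max (cshift m))).
- exact: rh_el_sq.
- rewrite -!rhM; [|exact: Rs|exact: Rs|exact: Rs|exact: Rs].
  rewrite !el_M //; congr (rh (el _ _ _)).
  by apply: dfunext => k; rewrite /seqD addrC.
have Kij : kerR (seqD (cshift i) (cshift j)).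
  apply: kerR_one_root o02 (inRD (Rs i) (Rs j)) _.
  by rewrite -el_M // rhM ?E ?rh_el_sq //; exact: Rs.
exists (j - i)%N; first by rewrite subn_gt0.
rewrite (_ : seqD _ _ = seqM (cunshift i) (seqD (cshift i) (cshift j))).
  by apply: kerRMl Kij; exact: inR_unshift.
apply: dfunext => k; rewrite -[seqM _ _ k]/(cunshift i k *m (cshift i k + cshift j k)) mulmxDr.
rewrite -(subnKC (ltnW ij)) -shiftD addKn [LHS]addrC mulmxA.
by rewrite -[cunshift i k *m cshift i k]/(seqM _ _ k) unshift_shift mul1mx.
Qed.

Let defect N i p := doubling i p (+) doubling i (p + N).

Lemma defect_mod N i p : defect N i (p %% 2 ^ i) = defect N i p.
Proof.
rewrite /defect doubling_mod -[doubling i (p %% _ + N)]doubling_mod modnDml.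
by rewrite doubling_mod.
Qed.

(** Modulo the ideal the shift T by N is 1, so D and its conjugate T D U agree; their difference is
    the diagonal matrix marking where the word differs from its translate by N. *)
Lemma kerR_defect N : kerR (seqD (cshift N) seq1) -> kerR (diag_seq (defect N)).
Proof.
move=> KN; set D := diag_seq doubling; set U := cunshift N; set T := cshift N.
have RD : inR D := inR_doubling.
have RU : inR U := inR_unshift N.
suff -> : diag_seq (defect N) =
    seqD (seqM (seqM (seqD T seq1) D) U) (seqM D (seqM U (seqD T seq1))).
  exact: kerRD (kerRMr (kerRMr KN RD) RU) (kerRMl RD (kerRMl RU KN)).
have -> : diag_seq (defect N) = seqD D (seqM (seqM T D) U).
  rewrite diag_conj; last exact: doubling_mod.
  apply: dfunext => i; apply/matrixP => p q; rewrite !mxE /defect.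
  by case: (p == q); case: doubling; case: doubling => //=; apply: val_inj.
have UT := unshift_shift N; apply: dfunext => i.
move/(congr1 (fun f : mseq (expn 2) => f i)): UT; rewrite /seqM /seqD /seq1 -/T -/U => UT.
rewrite !mulmxDl !mulmxDr UT !mul1mx !mulmx1 addrC -addrA; congr (_ + _).
by rewrite addrCA F2mx_addrr addr0.
Qed.

(** The diagonal is the product over t < L of 1 plus the defect shifted by t, and each factor is
    congruent to 1 modulo the ideal. *)
Lemma kerR_cover N L : kerR (diag_seq (defect N)) ->
  kerR (seqD (diag_seq (fun i p => all (fun t => ~~ defect N i (p + t)) (iota 0 L))) seq1).
Proof.
move=> KD; elim: L => [|L IH].
  rewrite (_ : seqD _ _ = seq0).
    by split=> [|a b ab]; [exact: inR0|rewrite el_0 rh1].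
  apply: dfunext => i; apply/matrixP => p q; rewrite !mxE andbT.
  by case: (p == q); apply: val_inj.
move: IH; set z := diag_seq _ => IH; have Rz : inR z.
  rewrite (_ : z = seqD (seqD z seq1) seq1); first by apply: inRD inR1; exact: IH.1.
  by apply: dfunext => i; rewrite /seqD -addrA F2mx_addrr addr0.
have KL : kerR (diag_seq (fun i p => defect N i (p + L))).
  by rewrite -diag_conj; [apply: kerRMr (inR_unshift _); apply: kerRMl KD; exact: inR_shift|exact: defect_mod].
have := kerRD IH (kerRMl Rz KL); congr kerR.
apply: dfunext => i; apply/matrixP => p q.
rewrite /seqD /seqM !mxE (bigD1 p) // big1 => [|r /negPf rp]; last first.
  by rewrite !mxE eq_sym rp mul0r.
have allS (f : nat -> bool) : all f (iota 0 L.+1) = all f (iota 0 L) && f L.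
  by rewrite -addn1 iotaD all_cat /= andbT add0n.
by rewrite !mxE eqxx allS; case: (p == q); case: all; case: defect; apply: val_inj.
Qed.

(** At levels i >= a + 2 every window of length 2^(a+2) contains a position of defect 1, so the
    product in [kerR_cover] vanishes there and the ideal contains the identity of those levels. *)
Lemma kerR_tail : exists s, kerR (cutR s seq1).
Proof.
have [N N0 /kerR_defect KD] := kerR_shift; pose a := logn 2 N.
exists a.+2; have := kerR_cut a.+2 (kerR_cover (2 ^ a.+2) KD); congr kerR.
apply: dfunext => i; rewrite /cutR; case: ltnP => // ai.
rewrite /seqD (_ : diag_seq _ i = 0) ?add0r //; apply/matrixP => p q; rewrite !mxE.
suff -> : all (fun t => ~~ defect N i (p + t)) (iota 0 (2 ^ a.+2)) = false by rewrite andbF.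
apply/negbTE/allPn; set L := (2 ^ a.+2)%N.
(* The offset below L that brings p to the residue 2^(a+1) modulo 2^(a+2), as [doubling_shift]
   requires. *)
exists ((2 ^ a.+1 + (L - p %% L)) %% L)%N.
  by rewrite mem_iota add0n /= ltn_mod expn_gt0.
have E : p + (2 ^ a.+1 + (L - p %% L)) %% L = 2 ^ a.+1 %[mod L].
  rewrite modnDmr -modnDml addnCA subnKC ?modnDr //.
  by apply: ltnW; rewrite ltn_mod expn_gt0.
have := doubling_shift N0 ai E; rewrite negbK /defect.
by case: doubling; case: doubling.
Qed.

(** The tail of each generator has its entry in the ideal, being a multiple of the tail of the
    identity; so tails of all elements act trivially, and two elements agreeing below s differ by
    such a tail. *)
Lemma rep_congruence : exists s, forall f g : Gam,
  (forall i, (i < s)%N -> gval f i = gval g i) -> rho f = rho g.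
Proof.
have [s Ks] := kerR_tail; exists s.
have H f : inG f -> rh (cutG s f) = 1%:M.
  elim=> [|a b j ab|x y Hx Ex Hy Ey]; first by rewrite cutG1 rh1.
    rewrite -el_cut (_ : cutR s _ = seqM (ring_gen j) (cutR s seq1)).
      by apply: (kerRMl (inR_gen j) Ks).2.
    by apply: dfunext => i; rewrite /seqM /cutR; case: ifP; rewrite ?mulmx0 ?mulmx1.
  by rewrite cutGM rhM ?Ex ?Ey ?mulmx1 //; exact: inG_cut.
move=> f g fg; rewrite -[g](mulKVg f) hr.2.
suff -> : rho (f^-1 * g)%g = 1%:M by rewrite mulmx1.
rewrite -(H _ (gvalP (f^-1 * g)%g)); congr rho; rewrite -[LHS]gvalK; congr toG.
apply: dfunext => i; rewrite /cutG; case: ifP => // si.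
rewrite gvalM gvalV /seqM /seqV fg // mulVmx //; exact: inG_unit (gvalP g).
Qed.
End CongruenceKernel.

(** * The bound on the number of representations *)

Definition giota i (g : 'M['F_2]_(deg i)) : Gam := toG (iota_at g).

Lemma gval_giota i (g : 'M[_]_(deg i)) : g \in unitmx -> gval (giota g) = iota_at g.
Proof. by move=> ug; rewrite toGK //; exact: inG_iota. Qed.

Lemma giota1 i : giota (1%:M : 'M[_]_(deg i)) = 1%g.
Proof. by apply: gval_inj; rewrite gval_giota ?unitmx1 // iota1. Qed.

Lemma giotaM i (g h : 'M[_]_(deg i)) : g \in unitmx -> h \in unitmx ->
  giota (g *m h) = (giota g * giota h)%g.
Proof.
move=> ug uh; apply: gval_inj.
by rewrite gvalM !gval_giota ?unitmx_mul ?ug // iotaM.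
Qed.

Lemma giotaC i j (g : 'M[_]_(deg i)) (h : 'M[_]_(deg j)) : i != j ->
  g \in unitmx -> h \in unitmx -> commute (giota g) (giota h).
Proof.
by move=> ij ug uh; apply: gval_inj; rewrite !gvalM !gval_giota // iotaC.
Qed.

Lemma giotaJ i (g : 'M[_]_(deg i)) (x : Gam) : g \in unitmx ->
  (x * giota g)%g = (giota (gval x i *m g *m invmx (gval x i)) * x)%g.
Proof.
move=> ug; have ux j : gval x j \in unitmx by exact: inG_unit (gvalP x).
apply: gval_inj; rewrite !gvalM !gval_giota ?unitmx_mul ?unitmx_inv ?ux ?ug //.
apply: dfunext => j; rewrite /seqM; have [<-|ij] := eqVneq i j.
  by rewrite !iota_in mulmxKV.
by rewrite !iota_out // mulmx1 mul1mx.
Qed.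

Lemma deg_ge i : (2 ^ i <= deg i - 2)%N.
Proof. by rewrite /deg; have := expn_gt0 2 i; lia. Qed.

Section Irr.
Variables (n L : nat) (rho : Gam -> 'M[C]_n).
Hypotheses (hr : is_rep rho) (hi : rep_irreducible rho) (nL : (n < 2 ^ L.+1)%N).

(** The dimension is too small for a chain of positive length, so GL at level i has a nonzero fixed
    vector. This factor is normalized by the whole group ([giotaJ]), so its fixed space is a
    subrepresentation and is everything. *)
Lemma irr_trivial_at i (g : 'M[_]_(deg i)) : (4 * L < 2 ^ i)%N -> g \in unitmx ->
  rho (giota g) = 1%:M.
Proof.
move=> Li ug; have [n0 irr] := hi; pose r := @rep_at _ _ giota n rho i.
have hu : unithom r := rep_at_unithom giota1 giotaM i hr.
have [||b [E [[G1 G2] bd bE]]] := (chain_pair _ (deg i)).1 n r 1%:M hu.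
- by move=> h uh; rewrite submx_full // row_full_unit unitmx1.
- by rewrite -mxrank_eq0 mxrank1 -lt0n.
have EL : (E <= L)%N.
  rewrite -ltnS -(ltn_exp2l _ _ (isT : (1 < 2)%N)); apply: leq_ltn_trans nL.
  by move: G2; rewrite mxrank1; apply: leq_trans; rewrite leq_pmulr.
(* With d = deg i and j = size b <= d, the chain bound gives j (d - 2) <= 4 E <= 4 L, whereas 4 L <
   2^i <= d - 2. *)
have b0 : size b = 0 by have := deg_ge i; nia.
have bn : b = [::] by case: b b0 {G1 G2 bd bE}.
move: G1; rewrite bn => G1; set U := eigsp [::] r in G1.
have HU h : h \in unitmx -> U *m r h = U.
  move=> uh; suff /eigenspaceP -> : (U <= eigenspace (r h) 1)%MS by rewrite scale1r.
  by rewrite /U /= (bigcapmx_inf h).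
have [x|U0|fU] := irr U.
- rewrite [X in (_ <= X)%MS](_ : _ = \bigcap_(g | g \in unitmx) eigenspace (r g) 1)%MS //.
  apply/sub_bigcapmxP => h uh; apply/eigenspaceP.
  rewrite scale1r -mulmxA -[r h]/(rho (giota h)) -hr.2 giotaJ // hr.2 mulmxA.
  have ux : gval x i \in unitmx by exact: inG_unit (gvalP x).
  by rewrite -[rho (giota _)]/(r _) HU // !unitmx_mul ux uh unitmx_inv.
- by move: G1; rewrite U0 capmx0 mxrank0.
- have /submxP[D D1] : (1%:M <= U)%MS by rewrite submx_full.
  by rewrite -[LHS]mul1mx D1 -mulmxA -[rho _]/(r g) HU.
Qed.

(** The level from [rep_congruence] depends on rho; the levels above s are then removed one at a
    time by [irr_trivial_at], leaving a level that depends on L alone. *)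
Lemma irr_finite_level s : (4 * L < 2 ^ s)%N -> forall x y : Gam,
  (forall i, (i < s)%N -> gval x i = gval y i) -> rho x = rho y.
Proof.
move=> Ls; have [s0 H] := rep_congruence hr.
suff D k : (forall x y : Gam, (forall i, (i < s + k)%N -> gval x i = gval y i) -> rho x = rho y) ->
    forall x y : Gam, (forall i, (i < s)%N -> gval x i = gval y i) -> rho x = rho y.
  apply: (D s0) => x y xy; apply: H => i is0; apply: xy.
  by apply: leq_trans is0 (leq_addl _ _).
elim: k => [|k IH] Hk; first by move: Hk; rewrite addn0.
apply: IH => x y xy; set j := (s + k)%N in xy.
have ux i : gval x i \in unitmx by exact: inG_unit (gvalP x).
have uy i : gval y i \in unitmx by exact: inG_unit (gvalP y).
have uz : invmx (gval x j) *m gval y j \in unitmx by rewrite unitmx_mul unitmx_inv ux uy.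
have -> : rho x = rho (x * giota (invmx (gval x j) *m gval y j))%g.
  rewrite hr.2 irr_trivial_at ?mulmx1 //; apply: leq_trans Ls _.
  by rewrite leq_exp2l // leq_addr.
apply: Hk => i; rewrite addnS ltnS leq_eqVlt gvalM gval_giota // /seqM.
case: eqP => [->|/eqP ij /= ij']; first by rewrite iota_in mulKVmx.
by rewrite iota_out 1?eq_sym // mulmx1 xy.
Qed.
End Irr.

Definition truncate s (x : Gam) : Gam :=
  (x * (toG (cutG s (gval x)))^-1)%g.

Lemma truncE s x i : gval (truncate s x) i = if (i < s)%N then gval x i else 1%:M.
Proof.
have ux : gval x i \in unitmx by exact: inG_unit (gvalP x).
rewrite gvalM gvalV toGK; last exact: inG_cut (gvalP x).
by rewrite /seqM /seqV /cutG; case: ifP => _; rewrite ?invmx1 ?mulmx1 ?mulmxV.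
Qed.

Lemma mem_fin_part s (x : Gam) : (forall i, (s <= i)%N -> gval x i = 1%:M) ->
  x \in fin_part giota s.
Proof.
elim: s x => [|s IH] x Hx.
  by rewrite inE; apply/eqP/gval_inj/dfunext => i; rewrite Hx.
have ux : gval x s \in unitmx by exact: inG_unit (gvalP x).
apply/fin_partS; exists (x * giota (invmx (gval x s)))%g, (gval x s); split=> //.
  apply: IH => i; rewrite leq_eqVlt gvalM gval_giota ?unitmx_inv // /seqM.
  case: eqP => [<- _|/eqP si /= si']; first by rewrite iota_in mulmxV.
  by rewrite iota_out // mulmx1 Hx.
by rewrite -mulgA -giotaM ?unitmx_inv // mulVmx // giota1 mulg1.
Qed.

(** For j <= d = deg i, the chain bound with exponent at most L gives j (d - 2) <= 4 L. *)
Definition maxbits L i : nat := minn (deg i) (4 * L %/ (deg i - 2)).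
Definition level L : nat := (trunc_log 2 (4 * L)).+1.
Definition irr_bound L : nat :=
  (\prod_(i < level L) 2 ^ (maxbits L i).+1) ^ 2 * \prod_(i < level L) deg i ^ maxbits L i.

Lemma level_lt L : (4 * L < 2 ^ level L)%N.
Proof. exact: trunc_log_ltn. Qed.

Lemma Gam_irr_bound L N (n : 'I_N -> nat) (rho : forall a, Gam -> 'M[C]_(n a)) :
  (forall a, is_rep (rho a)) -> (forall a, rep_irreducible (rho a)) ->
  (forall a, (n a < 2 ^ L.+1)%N) ->
  (forall a a', a != a' -> ~ rep_iso (rho a) (rho a')) -> (N <= irr_bound L)%N.
Proof.
move=> hr hi nL hn.
have hm a : finite_model (fin_part giota (level L)) (rho a) (truncate (level L)).
  move=> x; split; first by apply: mem_fin_part => i si; rewrite truncE ltnNge si.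
  apply: (irr_finite_level (hr a) (hi a) (nL a) (level_lt L)) => i si.
  by rewrite truncE si.
apply: (irr_family_bound _ giota1 giotaM giotaC _ hr hi hm hn nL).
- by move=> i; rewrite /deg muln_gt0 expn_gt0.
- move=> i j E EL jd jE; rewrite leq_min jd leq_divRL; last exact: leq_trans (expn_gt0 2 i) (deg_ge i).
  have := deg_ge i; have := expn_gt0 2 i; nia.
Qed.

(** * Numerical estimates of the bound *)

Lemma leq_pow_base a b m : (a <= b -> a ^ m <= b ^ m)%N.
Proof. by move=> ab; case: m => [|m] //; rewrite leq_exp2r. Qed.

(** For j = [maxbits L i] and d = deg i >= 3, j^2 <= j d <= 3 j (d - 2) <= 12 L: types have length
    of order sqrt L at every level. *)
Lemma maxbits_sqr L i : (maxbits L i * maxbits L i <= 12 * L)%N.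
Proof.
have d0 := deg_ge i; have p0 := expn_gt0 2 i.
have : (maxbits L i * (deg i - 2) <= 4 * L)%N.
  by rewrite -leq_divRL; [exact: geq_minr|lia].
have : (maxbits L i <= deg i)%N by exact: geq_minl.
nia.
Qed.

Lemma irr_bound_le L M : (forall i, (maxbits L i <= M)%N) ->
  (irr_bound L <= 2 ^ ((level L + 3) ^ 2 * M.+1))%N.
Proof.
move=> HM; set s := level L.
have A : (\prod_(i < s) 2 ^ (maxbits L i).+1 <= 2 ^ (s * M.+1))%N.
  rewrite mulnC expnM -[s in (_ ^ s)%N]card_ord -prod_nat_const.
  by apply: leq_prod => i _; rewrite leq_exp2l // ltnS.
have B : (\prod_(i < s) deg i ^ maxbits L i <= 2 ^ (s * ((s + 1) * M)))%N.
  rewrite mulnC expnM -[s in (_ ^ s)%N]card_ord -prod_nat_const.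
  apply: leq_prod => i _; apply: (@leq_trans ((2 ^ (s + 1)) ^ maxbits L i)).
    apply: leq_pow_base; rewrite /deg (leq_trans (_ : 3 * 2 ^ i <= 2 ^ (i + 2))%N) //.
      by rewrite expnD; lia.
    by rewrite leq_exp2l // addn2 addn1 ltnS.
  by rewrite -expnM leq_exp2l // leq_mul2l HM orbT.
apply: leq_trans (leq_mul (leq_pow_base 2 A) B) _.
(* The exponents are 2 s (M + 1) from the pairs of types and s (s + 1) M from the test points, as
   deg i <= 2^(s+1) for i < s. *)
rewrite -expnM -expnD leq_exp2l //; nia.
Qed.

Lemma level_growth c : exists L0, forall L, (L0 <= L)%N -> (c * (level L + 3) ^ 4 <= L)%N.
Proof.
(* Here 2^18 = 2^12 * 64: the first factor comes from t^4 <= (8 * 2^u)^4, the second from 2^t <= 64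
   L. The threshold makes T <= 2^(4u), so 64 c t^4 <= 2^(8u) <= 64 L. *)
pose T := (c * 2 ^ 18)%N; exists (2 ^ (8 * (T + 1)))%N => L LL.
set t := (level L + 3)%N; pose u := (t %/ 8)%N.
have tu : (t <= 8 * 2 ^ u)%N.
  have : (u < 2 ^ u)%N by exact: ltn_expl.
  by have := ltn_ceil t (isT : (0 < 8)%N); rewrite -/u; lia.
have L1 : (0 < L)%N by apply: leq_trans LL; rewrite expn_gt0.
have pL : (2 ^ (level L).-1 <= 4 * L)%N by apply: trunc_logP; lia.
have tL : (2 ^ t <= 64 * L)%N.
  rewrite /t /level addSn -addnS expnD; move: pL; rewrite /level /=; lia.
have ut : (8 * u <= t)%N by rewrite mulnC leq_divM.
have Tu : (T <= 2 ^ (4 * u))%N.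
  have tT : (8 * (T + 1) <= t)%N.
    rewrite -(@leq_exp2l 2) //; apply: leq_trans LL _; rewrite /t expnD.
    by have := level_lt L; lia.
  have uT : (T + 1 <= u)%N by rewrite leq_divRL // mulnC.
  apply: leq_trans (ltnW (ltn_expl T (isT : (1 < 2)%N))) _.
  by rewrite leq_exp2l //; lia.
have t4 : (t ^ 4 <= 2 ^ 12 * 2 ^ (4 * u))%N.
  apply: leq_trans (leq_pow_base 4 tu) _.
  by rewrite expnMn -!expnM (mulnC u).
have L8 : (2 ^ (4 * u) * 2 ^ (4 * u) <= 64 * L)%N.
  by rewrite -expnD; apply: leq_trans tL; rewrite leq_exp2l //; lia.
rewrite -(leq_pmul2l (isT : (0 < 64)%N)); apply: leq_trans L8.
apply: leq_trans (_ : 64 * (c * (2 ^ 12 * 2 ^ (4 * u))) <= _)%N.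
  by rewrite leq_pmul2l // leq_mul2l t4 orbT.
have -> : (64 * (c * (2 ^ 12 * 2 ^ (4 * u))) = T * 2 ^ (4 * u))%N.
  rewrite /T (_ : 2 ^ 18 = 64 * 2 ^ 12)%N; last by rewrite -[64%N]/(2 ^ 6)%N -expnD.
  by rewrite !mulnA (mulnC 64).
by rewrite leq_mul2r Tu orbT.
Qed.

(** The logarithm of the bound is at most t^2 (M + 1), with M the integer square root of 12 L and t
    logarithmic in L; p times this is o(L). The exponents are compared after squaring. *)
Lemma irr_bound_growth p : exists L0, forall L, (L0 <= L)%N -> (irr_bound L ^ p <= 2 ^ L)%N.
Proof.
have [L0 H] := level_growth (49 * p ^ 2); exists L0.+1 => L LL.
have L1 : (0 < L)%N by exact: leq_ltn_trans LL.
pose M := (\max_(i < (12 * L).+1 | i * i <= 12 * L) i)%N.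
have MM : (M * M <= 12 * L)%N.
  by rewrite /M; elim/big_ind: _ => // x y; rewrite /maxn; case: ifP.
have leM i : (maxbits L i <= M)%N.
  have Hi := maxbits_sqr L i.
  have lt_i : (maxbits L i < (12 * L).+1)%N by nia.
  exact: (@leq_bigmax_cond _ _ (fun i : 'I_(12 * L).+1 => i : nat) (Ordinal lt_i)).
apply: leq_trans (leq_pow_base p (irr_bound_le leM)) _.
rewrite -expnM leq_exp2l //; set t := (level L + 3)%N.
have ct : (49 * p ^ 2 * t ^ 4 <= L)%N by apply: H; exact: ltnW.
rewrite -leq_sqr; apply: leq_trans (_ : 49 * p ^ 2 * t ^ 4 * L <= _)%N; last first.
  by rewrite -mulnn leq_mul2r ct orbT.
rewrite (expnMn _ p 2) (expnMn (t ^ 2) M.+1 2) -expnM (_ : t ^ (2 * 2) = t ^ 4)%N //.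
(* From M <= M^2 <= 12 L and L >= 1: M^2 + 2 M + 1 <= 12 L + 24 L + L. *)
have M49 : (M.+1 ^ 2 <= 49 * L)%N by rewrite -mulnn; nia.
apply: leq_trans (_ : t ^ 4 * (49 * L) * p ^ 2 <= _)%N.
  by rewrite leq_mul2r leq_mul2l M49 !orbT.
by rewrite leq_eqVlt; apply/orP; left; apply/eqP; lia.
Qed.

(** * Representation growth *)

Section Covers.
Variable G : groupType.

Lemma rep_iso_sym m1 m2 (rho1 : G -> 'M[C]_m1) (rho2 : G -> 'M[C]_m2) :
  rep_iso rho1 rho2 -> rep_iso rho2 rho1.
Proof.
case=> e; case: m2 / e rho2 => rho2 [P [uP H]]; exists erefl, (invmx P).
split=> [|g]; first by rewrite unitmx_inv.
move: (H g); rewrite !castmx_id => Hg.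
by rewrite -[LHS]mul1mx -(mulVmx uP) -!mulmxA (mulmxA P) -Hg -!mulmxA mulmxV // mulmx1.
Qed.

Lemma In_map_enum (T : finType) (U : Type) (f : T -> U) y :
  List.In y [seq f x | x <- enum T] <-> exists x, f x = y.
Proof.
have H (s : seq T) : List.In y [seq f x | x <- s] <-> exists2 x, x \in s & f x = y.
  elim: s => [|x s IH] /=; first by split=> // -[].
  rewrite IH; split=> [[<-|[z zs <-]]|[z]].
  - by exists x; rewrite // mem_head.
  - by exists z; rewrite // inE zs orbT.
  - by rewrite inE => /orP[/eqP -> ->|zs fz]; [left|right; exists z].
rewrite H; split=> [[x _ <-]|[x <-]]; first by exists x.
by exists x; rewrite // mem_enum.
Qed.

Definition noniso_family n N (f : 'I_N -> drep G) :=
  (forall a, irr_upto n (f a)) /\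
  forall a a', a != a' -> ~ rep_iso (projT2 (f a)) (projT2 (f a')).

(** A family of pairwise non-isomorphic irreducibles of maximal size is a cover, since an
    irreducible isomorphic to none of its members would enlarge it. *)
Lemma covers_of_bound n K :
  (forall N (f : 'I_N -> drep G), noniso_family n f -> (N <= K)%N) ->
  exists2 k, (k <= K)%N & covers G n k.
Proof.
move=> HK; pose P N := `[< exists f : 'I_N -> drep G, noniso_family n f >].
have P0 : exists N, P N by exists 0; apply/asboolP; exists (fun=> existT (fun m => G -> 'M[C]_m) 0 (fun=> 0)); split=> -[].
have PK N : P N -> (N <= K)%N by move/asboolP => [f Hf]; exact: HK Hf.
case: (ex_maxnP P0 PK) => N /asboolP[f [f1 f2]] Nmax.
exists N; first by apply: HK; split; [exact: f1|exact: f2].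
exists [seq f a | a <- enum 'I_N]; rewrite size_map size_enum_ord; split=> //; split.
  by move=> r /In_map_enum[a <-].
move=> r Hr; apply: contrapT => none.
have none' a : ~ rep_iso (projT2 r) (projT2 (f a)).
  by move=> iso; apply: none; exists (f a) => //; apply/In_map_enum; exists a.
pose f' (a : 'I_N.+1) := if unlift ord0 a is Some b then f b else r.
suff /Nmax : P N.+1 by rewrite ltnn.
apply/asboolP; exists f'; split=> [a|a a']; rewrite /f'.
  by case: unliftP => [b|] _; [exact: f1|].
case: unliftP => [b|] ->; case: unliftP => [b'|] -> //.
- by rewrite (inj_eq lift_inj); exact: f2.
- by move=> _ /rep_iso_sym; exact: none'.
Qed.

(** The trivial representation has dimension 1 and must be covered; this keeps the logarithm in
    [rho_seq] nonnegative. *)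
Lemma R_count_ge1 n : (0 < n)%N -> (1 <= R_count G n)%E.
Proof.
move=> n0; apply: le_ereal_inf_tmp => _ [k [s [sk [_ Hs]]] <-].
pose triv : drep G := existT (fun m => G -> 'M[C]_m) 1 (fun=> 1%:M).
have [|r' r's _] := Hs triv.
  split=> //; split; first by split=> //= a b; rewrite mulmx1.
  split=> // U _; have [U0|U0] := eqVneq U 0; [by left|right].
  by rewrite /row_full eqn_leq rank_leq_col lt0n mxrank_eq0.
rewrite lee_fin ler1n; apply: leq_trans sk.
by case: s r's {Hs}.
Qed.
End Covers.

Local Open Scope classical_set_scope.
Local Open Scope ring_scope.

Local Notation RR := Rdefinitions.R.

Lemma Gam_covers n : exists2 k, (k <= irr_bound (trunc_log 2 n))%N & covers Gam n k.
Proof.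
apply: covers_of_bound => N f [f1 f2].
apply: (@Gam_irr_bound _ _ (fun a => projT1 (f a)) (fun a => projT2 (f a))) => [a|a|a|//].
- by have [_ []] := f1 a.
- by have [_ []] := f1 a.
- by have [na _] := f1 a; apply: leq_ltn_trans na (trunc_log_ltn _ _).
Qed.

Lemma Gam_R_count n : exists2 r : RR, R_count Gam n = r%:E &
  r <= (irr_bound (trunc_log 2 n))%:R /\ ((0 < n)%N -> 1 <= r).
Proof.
have [k kK cov] := Gam_covers n.
have le_k : (R_count Gam n <= (k%:R)%:E)%E by apply: ereal_inf_lbound; exists k.
have ge0 : (0 <= R_count Gam n)%E.
  by apply: le_ereal_inf_tmp => _ [j _ <-]; rewrite lee_fin ler0n.
have fin : R_count Gam n \is a fin_num.
  by rewrite ge0_fin_numE //; apply: le_lt_trans le_k (ltry _).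
exists (fine (R_count Gam n)); first by rewrite fineK.
split.
  by rewrite -lee_fin fineK //; apply: le_trans le_k _; rewrite lee_fin ler_nat.
by move=> n0; rewrite -lee_fin fineK //; exact: R_count_ge1.
Qed.

(** With L = trunc_log 2 n and n large, the p-th power of the count is at most 2^L <= n; take
    logarithms. *)
Lemma Gam_rho_seq_le p : (0 < p)%N -> \forall n \near \oo,
  exists2 x : RR, rho_seq Gam n = x%:E & 0 <= x <= p%:R^-1.
Proof.
move=> p0; have [L0 HL] := irr_bound_growth p.
exists (2 ^ L0.+1)%N => // n /= nL0.
have n2 : (2 <= n)%N by apply: leq_trans nL0; rewrite -[2%N]/(2 ^ 1)%N leq_exp2l.
have [r Er [rK /(_ (ltnW n2)) r1]] := Gam_R_count n.
rewrite /rho_seq Er; exists (ln r / ln n%:R) => //.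
have lnn : 0 < ln n%:R :> RR by rewrite ln_gt0 // ltr1n.
apply/andP; split; first by apply: divr_ge0; [exact: ln_ge0|exact: ltW].
rewrite ler_pdivrMr // ler_pdivlMl ?ltr0n //.
have r0 : 0 < r by apply: lt_le_trans r1.
rewrite mulr_natl -lnXn // ler_ln ?posrE ?exprn_gt0 ?ltr0n ?(ltnW n2) //.
set L := trunc_log 2 n in rK.
have LL : (L0 <= L)%N by rewrite ltnW // trunc_log_max.
apply: (@le_trans _ _ ((irr_bound L)%:R ^+ p)).
  by apply: lerXn2r; rewrite ?nnegrE ?ler0n // ltW.
rewrite -natrX ler_nat; apply: leq_trans (HL L LL) _.
by apply: trunc_logP => //; exact: ltnW.
Qed.

Lemma Gam_rep_growth : rep_growth Gam = (0 : RR)%:E.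
Proof.
rewrite /rep_growth; case: asboolP => [[n]|_].
  by have [r -> _] := Gam_R_count n.
suff H : rho_seq Gam @ \oo --> (0 : RR)%:E.
  by rewrite is_cvg_limn_esupE; [exact: cvg_lim H|apply/cvg_ex; eexists; exact: H].
apply: cvg_EFin.
  by apply: filterS (Gam_rho_seq_le (isT : (0 < 1)%N)) => n [x -> _].
apply/cvgrPdist_le => e e0.
pose p := (Num.bound e^-1).+1.
have pe : p%:R^-1 <= e.
  rewrite -[leRHS]invrK lef_pV2 ?posrE ?ltr0n ?invr_gt0 //.
  apply: ltW; apply: lt_le_trans (archi_boundP _) _; first by rewrite invr_ge0 ltW.
  by rewrite ler_nat.
apply: filterS (Gam_rho_seq_le (isT : (0 < p)%N)) => n [x /= -> /andP[x0 xp]].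
by rewrite sub0r normrN /= ger0_norm // (le_trans xp).
Qed.

Theorem theorem9p2 :
  exists Gamma : groupType,
    finitely_generated Gamma /\ residually_finite Gamma /\
    infinite_group Gamma /\ rep_growth Gamma = (0%R : Rdefinitions.R)%:E.
Proof.
exists Gam; split; first exact: Gam_fg.
split; first exact: Gam_rf.
by split; [exact: Gam_infinite|exact: Gam_rep_growth].
Qed.
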